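(* Let $\mathbb{G}$ be a two step stratified group equipped with a homogeneous distance $\rho$, and let $\Sigma\subset\mathbb{G}$ be a $C^2$ smooth submanifold. Then for every $x\in\Sigma$ there exists an algebraic variety $\mathcal{A}\subset\mathbb{G}$, which is the graph of a homogeneous polynomial function, such that the rescaled set $\delta_{1/r}l_{x^{-1}}\Sigma$ locally converges to $\mathcal{A}$ with respect to the Hausdorff distance of sets as $r\to0^+$; that is, for every $R>0$ the sets $\delta_{1/r}(l_{x^{-1}}\Sigma)\cap D_R$ converge to $\mathcal{A}\cap D_R$ in the Hausdorff distance as $r\to0^+$.
   Context: A two step stratified group $\mathbb{G}$ is a connected, simply connected, finite dimensional real Lie group whose Lie algebra $\mathcal{G}$ is a direct sum $\mathcal{G}=V_1\oplus V_2$ of nonzero subspaces with $[V_1,V_1]=V_2$ and $[V_1,V_2]=[V_2,V_2]=\{0\}$. The exponential map $\exp:\mathcal{G}\to\mathbb{G}$ is an analytic diffeomorphism. For $r>0$ the dilation $\delta_r:\mathcal{G}\to\mathcal{G}$ is $\delta_r(v_1+v_2)=rv_1+r^2v_2$ for $v_j\in V_j$; the same symbol denotes the induced map $\exp\circ\,\delta_r\circ\exp^{-1}$ on $\mathbb{G}$. Left translations are $l_x(y)=xy$. A homogeneous distance on $\mathbb{G}$ is a continuous distance $\rho:\mathbb{G}\times\mathbb{G}\to\mathbb{R}$ such that $\rho(ux,uy)=\rho(x,y)$ for all $u,x,y\in\mathbb{G}$ and $\rho(\delta_rx,\delta_ry)=r\,\rho(x,y)$ for all $x,y\in\mathbb{G}$,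 $r>0$. $D_R$ denotes the closed ball of radius $R$ centered at the unit element with respect to $\rho$, and the Hausdorff distance is taken with respect to $\rho$. Graded coordinates: fix a graded metric (a left invariant Riemannian metric for which $V_1$ and $V_2$ are orthogonal), let $q=\dim\mathcal{G}$, and let $(W_1,\dots,W_q)$ be an orthonormal basis of $\mathcal{G}$ whose first $\dim V_1$ elements form a basis of $V_1$ and whose remaining elements form a basis of $V_2$. The map $F:\mathbb{R}^q\to\mathbb{G}$, $F(y)=\exp(\sum_{i=1}^q y_iW_i)$, is a system of graded coordinates; the degree $d_i$ of $y_i$ is $1$ if $W_i\in V_1$ and $2$ if $W_i\in V_2$. A map $P:\mathbb{G}\to\mathbb{R}^k$ is polynomial if $P\circ\exp:\mathcal{G}\to\mathbb{R}^k$ has polynomial components with respect to linear bases. An algebraic variety in $\mathbb{G}$ is the zero set of a polynomial mapping $P:\mathbb{G}\to\mathbb{R}^k$ for some $k\ge1$. With $p=\dim\Sigma$, $\mathcal{A}$ is the graph of a homogeneous polynomial function if there are a system of graded coordinates $F$, a set $K\subset\{1,\dots,q\}$ of $p$ indices, and polynomials $T_j$ for $j\notin K$ in the variables $\xi=(\xi_i)_{i\in K}$ such that $\mathcal{A}=F(\{y\in\mathbb{R}^q\mid y_j=T_j((y_i)_{i\in K})\text{ for all }j\notin K\})$ and $T_j((r^{d_i}\xi_i)_{i\in K})=r^{d_j}T_j(\xi)$ for all $r>0$ and all $\xi$. *)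

(* Defs.v *)
From mathcomp Require Import all_boot all_order all_algebra.
From mathcomp Require Import all_classical all_reals all_analysis.
From mathcomp Require mpoly.

Set Implicit Arguments.
Unset Strict Implicit.
Unset Printing Implicit Defensive.

Import Order.TTheory GRing.Theory Num.Theory.
Import numFieldNormedType.Exports.

Local Open Scope classical_set_scope.
Local Open Scope ring_scope.

(* Meant for U open and V finite dimensional, where continuity of all the
   directional derivatives is continuity of the differential. *)
Fixpoint Ck (R : realType) (V W : normedModType R) (k : nat) (U : set V)
    (f : V -> W) : Prop :=
  match k with
  | 0 => forall x, U x -> {for x, continuous f}
  | k'.+1 => (forall x, U x -> differentiable f x) /\
             (forall v, Ck k' U (fun x => 'D_v f x))
  end.

(* A real Lie group G of dimension q whose exponential map is a global
   diffeomorphism; its Lie algebra T_1 G is 'rV[R]_q through a linear basis.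
   The manifold structure (hence also the topology) of G is the one for which
   exp is a diffeomorphism, so G is connected and simply connected.
   Through exp, inversion is v |-> - v, whence no smoothness axiom for it;
   and the velocity at 0 of the one-parameter group t |-> exp (t v), read in
   the chart log, is v. *)
Record exp_lie_group (R : realType) (q : nat) (G : groupType) := ExpLieGroup {
  lexp : 'rV[R]_q -> G;
  llog : G -> 'rV[R]_q;
  lexpK : cancel lexp llog;
  llogK : cancel llog lexp;
  lmul_smooth : forall k, Ck k setT (fun w : 'rV[R]_q * 'rV[R]_q =>
    llog (lexp w.1 * lexp w.2)%g);
  lexpD : forall (v : 'rV[R]_q) (s t : R),
    lexp ((s + t) *: v) = (lexp (s *: v) * lexp (t *: v))%g
}.

(* The value at exp w, in the chart log, of the left invariant vector field
   equal to v at the unit. *)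
Definition left_field (R : realType) (q : nat) (G : groupType)
    (L : exp_lie_group R q G) (v w : 'rV[R]_q) : 'rV[R]_q :=
  'D_v (fun u => llog L (lexp L w * lexp L u)%g) 0.

(* The commutator of the left invariant vector fields of u and v, evaluated at
   the unit: in a chart, [X, Y] = DY(X) - DX(Y). *)
Definition lie_bracket (R : realType) (q : nat) (G : groupType)
    (L : exp_lie_group R q G) (u v : 'rV[R]_q) : 'rV[R]_q :=
  'D_u (left_field L v) 0 - 'D_v (left_field L u) 0.

Record two_step_group (R : realType) (q : nat) (G : groupType) :=
  TwoStepGroup {
  lie_group :> exp_lie_group R q G;
  V1 : {vspace 'rV[R]_q};
  V2 : {vspace 'rV[R]_q};
  V1_neq0 : V1 != 0%VS;
  V2_neq0 : V2 != 0%VS;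
  V1V2_full : (V1 + V2 = fullv)%VS;
  V1V2_direct : (V1 :&: V2 = 0)%VS;
  (* [V1, V1] = V2, where [V1, V1] is the span of the brackets *)
  bracket11_sub : forall u v, u \in V1 -> v \in V1 ->
    lie_bracket lie_group u v \in V2;
  bracket11_span : forall U : {vspace 'rV[R]_q},
    (forall u v, u \in V1 -> v \in V1 -> lie_bracket lie_group u v \in U) ->
    (V2 <= U)%VS;
  bracket12 : forall u v, u \in V1 -> v \in V2 ->
    lie_bracket lie_group u v = 0;
  bracket22 : forall u v, u \in V2 -> v \in V2 ->
    lie_bracket lie_group u v = 0
}.

(* daddv_pi V1 V2 is the projection onto V1 along V2. *)
Definition dil (R : realType) (q : nat) (G : groupType)
    (S : two_step_group R q G) (r : R) (v : 'rV[R]_q) : 'rV[R]_q :=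
  r *: daddv_pi (V1 S) (V2 S) v + r ^+ 2 *: daddv_pi (V2 S) (V1 S) v.

Definition gdil (R : realType) (q : nat) (G : groupType)
    (S : two_step_group R q G) (r : R) (x : G) : G :=
  lexp S (dil S r (llog S x)).

Record homogeneous_distance (R : realType) (q : nat) (G : groupType)
    (S : two_step_group R q G) (rho : G -> G -> R) : Prop :=
  HomogeneousDistance {
  rho_eq0 : forall x y, rho x y = 0 <-> x = y;
  rho_sym : forall x y, rho x y = rho y x;
  rho_triangle : forall x y z, rho x z <= rho x y + rho y z;
  rho_continuous : continuous (fun w : 'rV[R]_q * 'rV[R]_q =>
    rho (lexp S w.1) (lexp S w.2));
  rho_left : forall u x y, rho (u * x)%g (u * y)%g = rho x y;
  rho_dil : forall r x y, 0 < r -> rho (gdil S r x) (gdil S r y) = r * rho x y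
}.

Definition cball1 (R : realType) (G : groupType) (rho : G -> G -> R) (e : R) :
  set G := [set x | rho 1%g x <= e].

Definition hausdorff_dist (R : realType) (G : Type) (rho : G -> G -> R)
    (A B : set G) : \bar R :=
  ereal_inf [set e%:E | e in [set e : R | [/\ 0 <= e,
    forall a, A a -> exists2 b, B b & rho a b <= e &
    forall b, B b -> exists2 a, A a & rho a b <= e]]].

(* The inner product on the Lie algebra defining a left invariant metric. *)
Record graded_metric (R : realType) (q : nat) (G : groupType)
    (S : two_step_group R q G) (g : 'rV[R]_q -> 'rV[R]_q -> R) : Prop :=
  GradedMetric {
  metric_linear : forall a u v w, g (a *: u + v) w = a * g u w + g v w;
  metric_sym : forall u v, g u v = g v u;
  metric_gt0 : forall v, v != 0 -> 0 < g v v;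
  metric_orth : forall u v, u \in V1 S -> v \in V2 S -> g u v = 0
}.

Definition graded_basis (R : realType) (q : nat) (G : groupType)
    (S : two_step_group R q G) (g : 'rV[R]_q -> 'rV[R]_q -> R)
    (W : 'I_q -> 'rV[R]_q) : Prop :=
  [/\ forall i j, g (W i) (W j) = (i == j)%:R,
      basis_of (V1 S) [seq W i | i : 'I_q <- enum 'I_q & (i < \dim (V1 S))%N] &
      basis_of (V2 S) [seq W i | i : 'I_q <- enum 'I_q & (\dim (V1 S) <= i)%N]].

Definition graded_coord (R : realType) (q : nat) (G : groupType)
    (S : two_step_group R q G) (W : 'I_q -> 'rV[R]_q) (y : 'rV[R]_q) : G :=
  lexp S (\sum_(i < q) y 0 i *: W i).

Definition coord_degree (R : realType) (q : nat) (G : groupType)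
    (S : two_step_group R q G) (W : 'I_q -> 'rV[R]_q) (i : 'I_q) : nat :=
  if W i \in V1 S then 1%N else 2%N.

Definition polynomial_map (R : realType) (q : nat) (G : groupType)
    (S : two_step_group R q G) (k : nat) (P : G -> 'rV[R]_k) : Prop :=
  exists Q : 'I_k -> mpoly.mpoly q R,
    forall (v : 'rV[R]_q) (i : 'I_k),
      P (lexp S v) 0 i = mpoly.meval (fun j => v 0 j) (Q i).

Definition algebraic_variety (R : realType) (q : nat) (G : groupType)
    (S : two_step_group R q G) (A : set G) : Prop :=
  exists (k : nat) (P : G -> 'rV[R]_k),
    [/\ (1 <= k)%N, polynomial_map S P & A = [set x | P x = 0]].

(* The variables of T j are numbered by 'I_#|K| through enum_val, i.e. xi k
   stands for the coordinate of index enum_val k in K; T j is only relevant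
   for j \notin K. *)
Definition homogeneous_polynomial_graph (R : realType) (q : nat)
    (G : groupType) (S : two_step_group R q G)
    (g : 'rV[R]_q -> 'rV[R]_q -> R) (p : nat) (A : set G) : Prop :=
  exists (W : 'I_q -> 'rV[R]_q) (K : {set 'I_q})
         (T : 'I_q -> mpoly.mpoly #|K| R),
    [/\ graded_basis S g W,
        #|K| = p,
        A = [set graded_coord S W y | y in [set y : 'rV[R]_q |
               forall j, j \notin K ->
                 y 0 j = mpoly.meval (fun k => y 0 (enum_val k)) (T j)]] &
        forall j, j \notin K -> forall (r : R) (xi : 'I_#|K| -> R), 0 < r ->
          mpoly.meval
            (fun k => r ^+ coord_degree S W (enum_val k) * xi k) (T j)
          = r ^+ coord_degree S W j * mpoly.meval xi (T j)].

(* Embedded submanifold of dimension p, through C^2 straightening charts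
   (Phi, with inverse Psi) of the chart log of G. *)
Definition C2_submanifold (R : realType) (q : nat) (G : groupType)
    (L : exp_lie_group R q G) (p : nat) (Sigma : set G) : Prop :=
  (p <= q)%N /\
  forall x, Sigma x ->
  exists (U O : set 'rV[R]_q) (Phi Psi : 'rV[R]_q -> 'rV[R]_q),
    [/\ [/\ open U, open O & U (llog L x)],
        [/\ forall y, U y -> O (Phi y) & forall y, U y -> Psi (Phi y) = y],
        [/\ forall z, O z -> U (Psi z) & forall z, O z -> Phi (Psi z) = z],
        Ck 2 U Phi /\ Ck 2 O Psi &
        forall y, U y ->
          (Sigma (lexp L y) <-> forall i : 'I_q, (p <= i)%N -> Phi y 0 i = 0)].

Definition rescaled (R : realType) (q : nat) (G : groupType)
    (S : two_step_group R q G) (Sigma : set G) (x : G) (r : R) : set G :=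
  gdil S r^-1 @` [set (x^-1 * y)%g | y in Sigma].

(* Main.v *)
(* Only the smoothness of left translations and the linear dilations in the chart
   log are needed, not the group law. Let T be the tangent space at 0 of the image
   of Sigma under log o l_{x^-1}, and parametrize this image by T as
   s(t) = t + B(t, t) + o(|t|^2). Split T into the horizontal part T cap V1 and a
   complement, on which the projection pi2 to V2 is injective. For t = r a + r^2 b
   with a horizontal and b in the complement, s(t) rescaled by 1/r converges to
   a + pi2 b + pi2 B(a, a), uniformly for bounded a and b: the first order of the
   V1 components and the second order of the V2 components survive. Conversely a
   point of the image of homogeneous size O(r) has parameter of this form with a
   and b bounded, so no implicit function theorem is needed. The limit set is the
   graph of a quadratic map over (T cap V1) + pi2(T); coordinates adapted to this
   splitting come from Gram-Schmidt. Cutting with a closed ball is harmless because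
   the limit set is dilation invariant. *)

Require Import Defs.
From HB Require Import structures.
From mathcomp Require Import all_boot all_order all_algebra.
From mathcomp Require Import all_classical all_reals all_analysis.
From mathcomp Require Import ring lra.
From mathcomp Require mpoly.
Import -(notations) mpoly.
Set Implicit Arguments.
Unset Strict Implicit.
Unset Printing Implicit Defensive.
Import Order.TTheory GRing.Theory Num.Theory.
Import numFieldNormedType.Exports.
Local Open Scope classical_set_scope.
Local Open Scope ring_scope.

(** * Second order expansions *)

Lemma rV_norm_coord (R : realType) n (v : 'rV[R]_n) i : `|v 0 i| <= `|v|.
Proof.
rewrite [leRHS]/Num.Def.normr /= mx_normrE.
exact: (le_bigmax _ (fun ij => `|v ij.1 ij.2|) (0, i)).
Qed.

Lemma rV_norm_le (R : realType) n (v : 'rV[R]_n) c : 0 <= c ->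
  (forall i, `|v 0 i| <= c) -> `|v| <= c.
Proof.
move=> c0 vc; rewrite [leLHS]/Num.Def.normr /= mx_normrE.
by apply: bigmax_le => //= -[i j] _ /=; rewrite ord1.
Qed.

Lemma linearDZ (R : realType) (U W : lmodType R) (f : U -> W) : linear f ->
  [/\ f 0 = 0, (forall u v, f (u + v) = f u + f v),
      (forall u, f (- u) = - f u), (forall u v, f (u - v) = f u - f v) &
      (forall a u, f (a *: u) = a *: f u)].
Proof.
move=> lf.
have fD u v : f (u + v) = f u + f v by rewrite -[u]scale1r lf !scale1r.
have f0 : f 0 = 0 by apply: (addrI (f 0)); rewrite -fD !addr0.
have fN u : f (- u) = - f u by apply: (addrI (f u)); rewrite -fD !subrr.
split=> // [u v|a u]; first by rewrite fD fN.
by rewrite -[a *: u]addr0 lf f0 addr0.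
Qed.

Lemma rV_linear_sum (R : realType) n (W : lmodType R) (f : 'rV[R]_n -> W) v :
  linear f -> f v = \sum_i v 0 i *: f (delta_mx 0 i).
Proof.
move=> /linearDZ[f0 fD _ _ fZ].
rewrite {1}(row_sum_delta v) (big_morph f fD f0).
by apply: eq_bigr => i _; rewrite fZ.
Qed.

Lemma linear_bound (R : realType) n (W : normedModType R) (f : 'rV[R]_n -> W) :
  linear f -> exists2 C, 0 < C & forall v, `|f v| <= C * `|v|.
Proof.
move=> lf; exists (1 + \sum_i `|f (delta_mx 0 i)|).
  by rewrite ltr_pwDl// sumr_ge0.
move=> v; rewrite (rV_linear_sum _ lf) (le_trans (ler_norm_sum _ _ _))//.
rewrite mulrDl mul1r mulr_suml ler_wpDl// ler_sum// => i _.
by rewrite normrZ mulrC ler_wpM2l// rV_norm_coord.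
Qed.

Definition bilin (R : realType) (U V W : lmodType R) (B : U -> V -> W) :=
  (forall u, linear (B u)) /\ (forall v, linear (B ^~ v)).

Lemma bilin_bound (R : realType) n m (W : normedModType R)
    (B : 'rV[R]_n -> 'rV[R]_m -> W) :
  bilin B -> exists2 C, 0 < C & forall u v, `|B u v| <= C * `|u| * `|v|.
Proof.
move=> [lr ll].
have bi i : exists C, 0 < C /\ forall v, `|B (delta_mx 0 i) v| <= C * `|v|.
  by have [C C0 BC] := linear_bound (lr (delta_mx 0 i)); exists C.
have [C /all_and2[C0 BC]] := choice bi.
exists (1 + \sum_i C i); first by rewrite ltr_pwDl// sumr_ge0// => i _; rewrite ltW.
move=> u v; rewrite (rV_linear_sum u (ll v)).
rewrite (le_trans (ler_norm_sum _ _ _))//.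
rewrite -mulrA mulrDl mul1r mulr_suml ler_wpDl ?mulr_ge0//.
apply: ler_sum => i _; rewrite normrZ mulrCA; apply: ler_pM => //.
exact: rV_norm_coord.
Qed.

Lemma diff_eps (R : realType) (V W : normedModType R) (f : V -> W) x e :
  differentiable f x -> 0 < e ->
  \forall h \near 0, `|f (x + h) - f x - 'd f x h| <= e * `|h|.
Proof.
move=> /diff_locallyP[_ /eqaddoP fx] e0.
have := fx _ e0; apply: filterS => h /=.
rewrite -![(_ + _ : _ -> _) _]/(_ + _) -![(- _ : _ -> _) _]/(- _) /=.
by rewrite opprD addrA (addrC h).
Qed.

(** Second order Taylor expansion at [x]: [L] plays the role of the differential and [B] that of
    half the second differential. Linearity and bilinearity are stated separately. *)
Definition expand2 (R : realType) (V W : normedModType R) (f : V -> W) x L B :=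
  forall e, 0 < e -> \forall h \near (0 : V),
    `|f (x + h) - f x - L h - B h h| <= e * `|h| ^+ 2.

(** The derivative along a segment of the second order remainder is a combination of the first order
    remainders of the partial derivatives, weighted by the coordinates of [h]; each is o(|h|), so
    the whole is o(|h|^2). *)
Lemma taylor2 (R : realType) n m (f : 'rV[R]_n -> 'rV[R]_m) (x : 'rV[R]_n) :
  (\forall y \near x, differentiable f y) ->
  (forall i : 'I_n, differentiable (fun y : 'rV[R]_n => 'D_(delta_mx 0 i) f y) x) ->
  exists L B, [/\ linear L, bilin B & expand2 f x L B].
Proof.
move=> df ddf.
have [D DE] : exists D : 'I_n -> 'rV[R]_n -> 'rV[R]_m,
    D = fun i y => 'D_(delta_mx 0 i) f y by eexists.
have {}ddf i : differentiable (D i) x by rewrite DE; exact: ddf.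
have dD (y h : 'rV[R]_n) : differentiable f y -> 'd f y h = \sum_i h 0 i *: D i y.
  move=> dfy; rewrite (rV_linear_sum h (f := 'd f y)); last exact: linearP.
  by apply: eq_bigr => i _; rewrite DE deriveE.
clear DE.
pose B (h k : 'rV[R]_n) : 'rV[R]_m := 2^-1 *: \sum_i h 0 i *: 'd (D i) x k.
exists ('d f x), B; split; first exact: linearP.
  split=> [u a v w|v a u w]; rewrite /B.
    rewrite scalerA mulrC -scalerA -scalerDr; congr (_ *: _).
    rewrite scaler_sumr -big_split/=; apply: eq_bigr => i _.
    by rewrite linearP scalerDr !scalerA (mulrC a).
  rewrite scalerA mulrC -scalerA -scalerDr; congr (_ *: _).
  rewrite scaler_sumr -big_split/=; apply: eq_bigr => i _.
  by rewrite !mxE scalerDl scalerA.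
move=> e e0.
(* The tolerance is shared among the [n] coordinates; dividing by [n.+1] also covers [n = 0]. *)
have n0 : 0 < n.+1%:R :> R by rewrite ltr0n.
have e'0 : 0 < e / n.+1%:R by rewrite divr_gt0.
have dx := nbhs_singleton df.
have /nbhs_norm0P[d /= d0 dP] : \forall h \near (0 : 'rV[R]_n),
    differentiable f (x + h) /\
    forall i, `|D i (x + h) - D i x - 'd (D i) x h| <= e / n.+1%:R * `|h|.
  apply: filterI; first exact: ((nbhs0P (fun y => differentiable f y) x).1 df).
  apply: (filter_forall (F := nbhs (0 : 'rV[R]_n))).
  move=> i; have := diff_eps (ddf i) e'0. exact.
apply/nbhs_norm0P; exists d => //= h /= hd.
have thd (t : R) : 0 <= t <= 1 -> `|t *: h| < d.
  move=> /andP[t0 t1]; rewrite normrZ ger0_norm// (le_lt_trans _ hd)//.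
  by rewrite ler_piMl.
apply: rV_norm_le => [|j]; first by rewrite mulr_ge0 ?sqr_ge0// ltW.
(* The remainder is estimated along the segment from x to x + h by the mean
   value theorem, one coordinate at a time. *)
pose F (t : R) : R :=
  f (x + t *: h) 0 j - f x 0 j - t * ('d f x h) 0 j - t ^+ 2 * (B h h) 0 j.
have F1 : F 1 - F 0 = (f (x + h) - f x - 'd f x h - B h h) 0 j.
  rewrite /F !mxE scale1r scale0r addr0 expr1n; ring.
rewrite -F1.
(* The differentials are hidden behind variables because unifying two terms of
   the form ['d f x h] unfolds [diff] and does not terminate. *)
have [A AE] : exists A : R -> 'rV[R]_m, forall t, A t = 'd f (x + t *: h) h.
  by exists (fun t => 'd f (x + t *: h) h).
pose F' (t : R) : R := (A t) 0 j - ('d f x h) 0 j - 2 * t * (B h h) 0 j.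
have dF (t : R) : 0 <= t <= 1 -> is_derive t 1 F (F' t).
  move=> t01; have dft : differentiable f (x + t *: h) by have [] := dP _ (thd _ t01).
  have dfl : is_derive t 1 (fun t => f (x + t *: h) 0 j) ((A t) 0 j).
    have dl : is_diff t (fun t : R => x + t *: h) (fun t : R => t *: h).
      have d12 := is_diffD (is_diff_cst x t) (is_diff_scalel t h).
      by rewrite add0r in d12; exact: d12.
    have dfl : differentiable (f \o (fun t : R => x + t *: h)) t.
      exact: differentiable_comp.
    have dr : derivable (f \o (fun t : R => x + t *: h)) t 1.
      exact: diff_derivable.
    have := (derivable_mxP _ _ _).1 dr 0 j => drj.
    apply: DeriveDef => //.
    have := derive_mx dr => /matrixP/(_ 0 j); rewrite mxE => <-; rewrite AE.
    by rewrite deriveE// diff_comp//= diff_val scale1r.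
  have d2 : is_derive t 1 (fun t : R => t * ('d f x h) 0 j) (('d f x h) 0 j).
    apply: is_derive_eq.
    by rewrite ?scaler0 ?addr0 ?add0r /GRing.scale/= mulr1.
  have d3 : is_derive t 1 (fun t : R => t ^+ 2 * (B h h) 0 j) (2 * t * (B h h) 0 j).
    apply: is_derive_eq.
    by rewrite ?scaler0 ?addr0 ?add0r /GRing.scale/=; ring.
  have d1 := is_deriveB dfl (is_derive_cst (f x 0 j) t (1 : R)).
  have d4 := is_deriveB (is_deriveB d1 d2) d3.
  by rewrite subr0 in d4.
have contF (t : R) : 0 <= t <= 1 -> {for t, continuous F}.
  move=> t01; apply: differentiable_continuous; apply/derivable1_diffP.
  by have [] := dF t t01.
have [c cI ->] : exists2 c, c \in `[0, 1] & F 1 - F 0 = F' c * (1 - 0).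
  apply: (@MVT_segment _ F F' 0 1) => // [t|].
    by rewrite in_itv /= => /andP[? ?]; apply: dF; rewrite !ltW.
  apply: continuous_in_subspaceT => t; rewrite inE /= in_itv /=; exact: contF.
rewrite subr0 mulr1.
have c01 : 0 <= c <= 1 by move: cI; rewrite in_itv.
have [dfc Dc] := dP _ (thd _ c01).
have := dD _ h dfc; rewrite -AE => Ac.
have [g [gZ gE]] : exists g : 'I_n -> 'rV[R]_m,
    (forall i, 'd (D i) x (c *: h) = c *: g i) /\
    B h h = 2^-1 *: \sum_i h 0 i *: g i.
  by exists (fun i => 'd (D i) x h); split => // i; rewrite linearZ.
have dDx := dD _ h dx.
have [a aE] : exists a : 'rV[R]_m, a = 'd f x h by eexists.
rewrite -aE in dDx.
(* The factor 2 from the derivative of [t ^+ 2] cancels the [2^-1] in [B], so that [F' c] is made of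
   first order remainders of the [D i] at [c *: h]. *)
have -> : F' c = (\sum_i h 0 i *: (D i (x + c *: h) - D i x - c *: g i)) 0 j.
  have -> : (\sum_i h 0 i *: (D i (x + c *: h) - D i x - c *: g i)) =
      A c - a - c *: \sum_i h 0 i *: g i.
    rewrite Ac dDx -sumrB scaler_sumr -sumrB; apply: eq_bigr => i _.
    by rewrite !scalerBr !scalerA (mulrC c).
  rewrite /F' -aE gE !mxE; congr (_ - _).
  by rewrite mulrAC mulrA divff ?pnatr_eq0// mul1r mulrC.
apply: (le_trans (rV_norm_coord _ _)).
apply: (le_trans (ler_norm_sum _ _ _)).
apply: (@le_trans _ _ (\sum_(i < n) e / n.+1%:R * `|h| ^+ 2)).
  apply: ler_sum => i _; rewrite normrZ expr2 mulrCA.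
  apply: ler_pM => //; first exact: rV_norm_coord.
  rewrite -gZ; apply: (le_trans (Dc i)); rewrite ler_wpM2l ?(ltW e'0)//.
  by rewrite normrZ ger0_norm ?ler_piMl//; case/andP: c01.
rewrite sumr_const card_ord -[leLHS]mulr_natr mulrAC ler_wpM2r ?sqr_ge0//.
rewrite -mulrA ler_piMr ?(ltW e0)// mulrC ler_pdivrMr// mul1r ler_nat; exact: leqnSn.
Qed.

(** For [|h| < 1] the quadratic terms are bounded by linear ones; the final [1] in the constant is
    the remainder taken at [e = 1]. *)
Lemma expand2_le (R : realType) (V W : normedModType R) (f : V -> W) x L B cL cB :
  0 < cL -> 0 < cB -> (forall h, `|L h| <= cL * `|h|) ->
  (forall u v, `|B u v| <= cB * `|u| * `|v|) -> expand2 f x L B ->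
  \forall h \near 0, `|f (x + h) - f x| <= (cL + cB + 1) * `|h|.
Proof.
move=> cL0 cB0 Lb Bb fx; have := fx 1 ltr01.
apply: filterS2 (nbhs0_lt (V := V) ltr01) => h h1 fh.
have -> : f (x + h) - f x = (f (x + h) - f x - L h - B h h) + (L h + B h h).
  by rewrite (addrC (L h)) addrA !subrK.
apply: (le_trans (ler_normD _ _)); apply: (le_trans (lerD fh (ler_normD _ _))).
apply: (le_trans (lerD (lexx _) (lerD (Lb h) (Bb h h)))).
have h0 := normr_ge0 h; set n := `|h| in h0 h1 *.
rewrite mul1r expr2 -mulrA; have : n * n <= n by rewrite ler_piMr // ltW.
move=> nn; have := ler_wpM2l (ltW cB0) nn; lra.
Qed.

(** Second order chain rule: the quadratic term of the composite collects the image under [M] of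
    that of [f], and that of [g] along the first order increment [L h]. *)
Lemma expand2_comp (R : realType) n m l (f : 'rV[R]_n -> 'rV[R]_m)
    (g : 'rV[R]_m -> 'rV[R]_l) x L B M C :
  linear L -> bilin B -> linear M -> bilin C ->
  expand2 f x L B -> expand2 g (f x) M C ->
  expand2 (g \o f) x (M \o L) (fun h k => M (B h k) + C (L h) (L k)).
Proof.
move=> lL lB lM lC fx gx e e0.
have [a a0 La] := linear_bound lL.
have [b b0 Bb] := bilin_bound lB.
have [c c0 Mc] := linear_bound lM.
have [d d0 Cd] := bilin_bound lC.
have [_ MD _ MB _] := linearDZ lM.
have fK := expand2_le a0 b0 La Bb fx.
set K := a + b + 1 in fK.
have K0 : 0 < K by rewrite /K; lra.
(* The error [e] is split into three equal parts. The factor [K ^+ 2] converts the increment of [f]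
   into [h]; the cap by 1 in the precision for [f] gives [|k - L h| <= (b + 1) * |h| ^+ 2]. *)
have e2 : 0 < e / (3 * K ^+ 2) by rewrite divr_gt0// mulr_gt0// exprn_gt0.
have e1 : 0 < Num.min 1 (e / (3 * c)) by rewrite lt_min ltr01 divr_gt0// mulr_gt0.
have r0 : 0 < e / (3 * (d * (b + 1) * (K + a))).
  by rewrite divr_gt0// !mulr_gt0//; lra.
have /nbhs_norm0P[s /= s0 gs] := gx _ e2.
near=> h.
have fh : `|f (x + h) - f x| <= K * `|h| by near: h.
have fh1 : `|f (x + h) - f x - L h - B h h| <= Num.min 1 (e / (3 * c)) * `|h| ^+ 2.
  by near: h; exact: fx.
have hs : `|h| < s / K by near: h; apply: (@nbhs0_lt _ 'rV[R]_n); rewrite divr_gt0.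
have hr : `|h| < e / (3 * (d * (b + 1) * (K + a))).
  by near: h; exact: (@nbhs0_lt _ 'rV[R]_n).
rewrite /=.
set k := f (x + h) - f x in fh fh1.
have gk : `|g (f x + k) - g (f x) - M k - C k k| <= e / (3 * K ^+ 2) * `|k| ^+ 2.
  by apply: gs => /=; rewrite (le_lt_trans fh)// mulrC -ltr_pdivlMr.
have kE : f x + k = f (x + h) by rewrite /k addrC subrK.
rewrite kE in gk.
set t := k - L h - B h h in fh1.
(* Three errors: the remainder of [g] at the increment [k], the image under [M] of the remainder [t]
   of [f], and the cost of replacing [k] by [L h] in both arguments of [C]. *)
have -> : g (f (x + h)) - g (f x) - M (L h) - (M (B h h) + C (L h) (L h)) =
  (g (f (x + h)) - g (f x) - M k - C k k) + M t + (C (k - L h) k + C (L h) (k - L h)).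
  have [_ _ _ CB _] := linearDZ (lC.1 (L h)); rewrite CB.
  have [_ _ _ CB' _] := linearDZ (lC.2 k).
  rewrite (CB' k (L h) : C (k - L h) k = C k k - C (L h) k).
  rewrite /t !MB; set A1 := g _ - _; set A2 := M k; set A3 := M (L h).
  set A4 := M (B h h); set A5 := C k k; set A6 := C (L h) (L h); set A7 := C (L h) k.
  by apply/rowP => i; rewrite !mxE; ring.
have n0 := normr_ge0 h.
have kL : `|k - L h| <= (b + 1) * `|h| ^+ 2.
  have -> : k - L h = t + B h h by rewrite /t subrK.
  apply: (le_trans (ler_normD _ _)); apply: (le_trans (lerD fh1 (Bb h h))).
  rewrite -mulrA -expr2 -mulrDl ler_wpM2r ?sqr_ge0// addrC lerD2l.
  by rewrite ge_min lexx.
apply: (le_trans (ler_normD _ _)).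
apply: (le_trans (lerD (ler_normD _ _) (ler_normD _ _))).
set z := `|h| in n0 hr hs fh kL fh1 *.
have b1 : `|g (f (x + h)) - g (f x) - M k - C k k| <= e / 3 * z ^+ 2.
  apply: (le_trans gk); rewrite invfM -!mulrA ler_pM2l// ler_pM2l ?invr_gt0//.
  rewrite ler_pdivrMl ?exprn_gt0//.
  by rewrite -exprMn lerXn2r ?nnegrE// mulr_ge0// ltW.
have b2 : `|M t| <= e / 3 * z ^+ 2.
  apply: (le_trans (Mc t)); rewrite -ler_pdivlMl//; apply: (le_trans fh1).
  rewrite [leRHS]mulrA ler_wpM2r ?sqr_ge0// ge_min; apply/orP; right.
  by rewrite invfM [leRHS]mulrC mulrA.
have b3 : `|C (k - L h) k| + `|C (L h) (k - L h)| <= e / 3 * z ^+ 2.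
  apply: (le_trans (lerD (Cd _ _) (Cd _ _))).
  apply: (@le_trans _ _
    (d * ((b + 1) * z ^+ 2) * (K * z) + d * (a * z) * ((b + 1) * z ^+ 2))).
    have d0' := ltW d0.
    by apply: lerD; (apply: ler_pM; rewrite ?mulr_ge0//; apply: ler_pM).
  have -> : d * ((b + 1) * z ^+ 2) * (K * z) + d * (a * z) * ((b + 1) * z ^+ 2) =
    (d * (b + 1) * (K + a)) * z * z ^+ 2 by ring.
  rewrite ler_wpM2r ?sqr_ge0// mulrC -ler_pdivlMr; last first.
    by rewrite !mulr_gt0//; lra.
  by move/ltW: hr; rewrite invfM mulrA.
lra.
Unshelve. all: by end_near. Qed.

Lemma linear_comp (R : realType) (U V W : lmodType R) (f : U -> V) (g : V -> W) :
  linear f -> linear g -> linear (g \o f).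
Proof. by move=> lf lg a u v; rewrite /= lf lg. Qed.

Lemma bilin_comp (R : realType) (U V W : lmodType R) (L : U -> V)
    (B : U -> U -> V) (M : V -> W) (C : V -> V -> W) :
  linear L -> bilin B -> linear M -> bilin C ->
  bilin (fun h k => M (B h k) + C (L h) (L k)).
Proof.
move=> lL [B1 B2] lM [C1 C2]; split=> [u a v w|v a u w].
  by rewrite B1 lL lM C1 scalerDr addrACA.
by rewrite (B2 v) lL lM (C2 (L v)) scalerDr addrACA.
Qed.

(** * Coordinate subspaces, the flat models of a straightened submanifold *)

Definition coordsub (R : realType) (q p : nat) : {vspace 'rV[R]_q} :=
  span [seq (delta_mx 0 i : 'rV[R]_q) | i : 'I_q <- enum 'I_q & (i < p)%N].

Lemma mem_coordsub (R : realType) q p (h : 'rV[R]_q) :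
  reflect (forall i : 'I_q, (p <= i)%N -> h 0 i = 0) (h \in coordsub R q p).
Proof.
apply: (iffP idP) => [hE i pi|hp].
  have lc : linear (fun u : 'rV[R]_q => u 0 i : R^o).
    by move=> a u v; rewrite !mxE.
  pose F : {linear 'rV[R]_q -> R^o} := HB.pack (fun u : 'rV[R]_q => u 0 i : R^o)
    (GRing.isLinear.Build _ _ _ _ _ lc).
  have /subvP/(_ _ hE) : (coordsub R q p <= lker (linfun F))%VS.
    apply/span_subvP => _ /mapP[j + ->]; rewrite mem_filter => /andP[jp _].
    rewrite memv_ker lfunE /= mxE eqxx /=.
    case: (eqVneq i j) => [ij|]; last by rewrite eqxx.
    by move: pi; rewrite ij leqNgt jp.
  by rewrite memv_ker lfunE /= => /eqP.
rewrite (row_sum_delta h); apply: memv_suml => i _.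
have [ip|/hp ->] := ltnP i p; last by rewrite scale0r mem0v.
apply/memvZ/memv_span/mapP; exists i => //.
by rewrite mem_filter ip mem_enum.
Qed.

Lemma count_ord_lt q p : (p <= q)%N -> count (fun i : 'I_q => i < p)%N (enum 'I_q) = p.
Proof.
move=> pq; rewrite -(count_map val (fun i => i < p)%N) val_enum_ord.
rewrite -(subnKC pq) iotaD count_cat.
rewrite (_ : count _ (iota 0 p) = p); last first.
  rewrite -[RHS](size_iota 0 p); apply/eqP; rewrite -all_count.
  by apply/allP => i; rewrite mem_iota.
rewrite (_ : count _ _ = 0%N) ?addn0//; apply/eqP; rewrite eqn0Ngt -has_count.
by apply/hasPn => i; rewrite mem_iota add0n -leqNgt => /andP[].
Qed.

(** The first [p] coordinate vectors span at most [p] dimensions and the others at most [q - p];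
    together they span everything, so the first bound is an equality. *)
Lemma dim_coordsub (R : realType) q p : (p <= q)%N -> \dim (coordsub R q p) = p.
Proof.
move=> pq; set E := coordsub R q p.
pose X := [seq (delta_mx 0 i : 'rV[R]_q) | i : 'I_q <- enum 'I_q & (i < p)%N].
have sX : size X = p by rewrite size_map size_filter count_ord_lt.
pose X' := [seq (delta_mx 0 i : 'rV[R]_q) | i : 'I_q <- enum 'I_q & ~~ (i < p)%N].
have sX' : size X' = (q - p)%N.
  have cp := count_predC (fun i : 'I_q => i < p)%N (enum 'I_q).
  rewrite count_ord_lt// size_enum_ord in cp.
  by rewrite size_map size_filter; apply/eqP; rewrite -(eqn_add2l p) cp subnKC.
have full : (fullv <= <<X>> + <<X'>>)%VS.
  apply/subvP => h _; rewrite (row_sum_delta h); apply: memv_suml => i _; apply: memvZ.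
  have [ip|ip] := boolP (i < p)%N.
    apply/(subvP (addvSl _ _))/memv_span/mapP; exists i => //.
    by rewrite mem_filter ip mem_enum.
  apply/(subvP (addvSr _ _))/memv_span/mapP; exists i => //.
  by rewrite mem_filter ip mem_enum.
have d1 := dim_span X; have d2 := dim_span X'.
have := leq_trans (dimvS full) (dimv_add_leqif _ _).1.
rewrite dimvf /dim /= mul1n => dq.
rewrite sX in d1; rewrite sX' in d2.
apply/eqP; rewrite eqn_leq d1 /= -(leq_add2r (q - p)) subnKC//.
by apply: leq_trans dq _; rewrite leq_add2l.
Qed.

(** * Parametrization of a submanifold by its tangent space *)

Lemma near_openD (R : realType) (V : normedModType R) (U : set V) (x : V) :
  open U -> U x -> \forall h \near (0 : V), U (x + h).
Proof.
move=> oU Ux; apply: ((nbhs0P U x).1 _).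
exact: (open_nbhs_nbhs (conj oU Ux)).
Qed.

Lemma diff_lip (R : realType) n (W : normedModType R) (f : 'rV[R]_n -> W) x :
  differentiable f x ->
  exists2 C, 0 < C & \forall h \near (0 : 'rV[R]_n), `|f (x + h) - f x| <= C * `|h|.
Proof.
move=> df; have [c c0 dc] := linear_bound (f := 'd f x) ltac:(exact: linearP).
exists (c + 1); first by rewrite addr_gt0.
have := diff_eps df ltr01; apply: filterS => h fh.
rewrite mulrDl -[_ - _](subrK ('d f x h)) addrC (le_trans (ler_normD _ _))//.
by rewrite lerD.
Qed.

(* [S0] is parametrized near [0] by its tangent space [T]; [B] is half the
   second differential of the parametrization [s]. *)
Definition param2 (R : realType) (q : nat) (S0 : set 'rV[R]_q)
    (T : {vspace 'rV[R]_q}) (s : 'rV[R]_q -> 'rV[R]_q)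
    (B : 'rV[R]_q -> 'rV[R]_q -> 'rV[R]_q) :=
  [/\ bilin B,
    forall e, 0 < e -> \forall h \near (0 : 'rV[R]_q), h \in T ->
      `|s h - h - B h h| <= e * `|h| ^+ 2,
    \forall h \near (0 : 'rV[R]_q), h \in T -> S0 (s h) &
    exists2 C, 0 < C & \forall v \near (0 : 'rV[R]_q), S0 v ->
      exists t, [/\ t \in T, `|t| <= C * `|v| & s t = v]].

(** [sigma] is an inverse chart with [sigma u0 = 0] and [phi] is its inverse. The tangent space is
    the image of the coordinate subspace under the differential [L]; reparametrizing [sigma] by the
    inverse of [L] makes the first order term the identity. *)
Lemma param2_chart (R : realType) (q p : nat) (S0 : set 'rV[R]_q)
    (sigma phi : 'rV[R]_q -> 'rV[R]_q) (u0 : 'rV[R]_q)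
    (L : 'rV[R]_q -> 'rV[R]_q) (B : 'rV[R]_q -> 'rV[R]_q -> 'rV[R]_q) C :
  (p <= q)%N -> linear L -> bilin B -> expand2 sigma u0 L B -> sigma u0 = 0 ->
  (\forall h \near (0 : 'rV[R]_q), h \in coordsub R q p -> S0 (sigma (u0 + h))) ->
  (\forall v \near (0 : 'rV[R]_q), S0 v ->
     phi v - u0 \in coordsub R q p /\ sigma (phi v) = v) ->
  (\forall h \near (0 : 'rV[R]_q), phi (sigma (u0 + h)) = u0 + h) ->
  0 < C -> (\forall v \near (0 : 'rV[R]_q), `|phi v - u0| <= C * `|v|) ->
  exists T s B', \dim T = p /\ param2 S0 T s B'.
Proof.
move=> pq lL lB sE s0 sS Sphi phis C0 phi_lip.
have [a a0 La] := linear_bound lL.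
have [b b0 Bb] := bilin_bound lB.
have sK := expand2_le a0 b0 La Bb sE.
set K := a + b + 1 in sK; have K0 : 0 < K by rewrite /K; lra.
pose F : 'End('rV[R]_q) := linfun (HB.pack L (GRing.isLinear.Build _ _ _ _ L lL)
  : {linear 'rV[R]_q -> 'rV[R]_q}).
have FE h : F h = L h by rewrite lfunE.
have [L0 _ _ _ LZ] := linearDZ lL.
(* [sigma] would move [u0 + h], for [h] in the kernel, only to second order,
   against the Lipschitz bound on its inverse [phi]. *)
have F0 : lker F == 0%VS.
  rewrite -subv0; apply/subvP => h; rewrite memv_ker FE memv0 => /eqP Lh0.
  apply: contraT => hn0.
  have h0 : 0 < `|h| by rewrite normr_gt0.
  have e0 : 0 < 1 / (3 * (b + 1) * C) by rewrite divr_gt0 ?mulr_gt0//; lra.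
  have /nbhs_norm0P[d /= d0 dP] : \forall h \near (0 : 'rV[R]_q),
    [/\ `|sigma (u0 + h) - sigma u0 - L h - B h h| <= 1 * `|h| ^+ 2,
        phi (sigma (u0 + h)) = u0 + h &
        `|phi (sigma (u0 + h)) - u0| <= C * `|sigma (u0 + h)|].
    have /nbhs_norm0P[d' /= d'0 dP'] := phi_lip.
    near=> k; split; [by near: k; exact: sE|by near: k|]; apply: dP' => /=.
    rewrite -[sigma _]subr0 -s0; apply: (@le_lt_trans _ _ (K * `|k|)).
      by near: k; exact: sK.
    rewrite mulrC -ltr_pdivlMr//; near: k.
    by apply: (@nbhs0_lt _ 'rV[R]_q); rewrite divr_gt0.
  (* A vector [k] of length [m] along [h] satisfies [m <= C * (1 + b) * m ^+ 2], whereas the choice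
     of [m] makes the right-hand side at most [m / 3]. *)
  pose m := Num.min (d / 2) (1 / (3 * (b + 1) * C)).
  have m0 : 0 < m by rewrite lt_min e0 divr_gt0.
  have md : m < d by rewrite (@le_lt_trans _ _ (d / 2)) ?ge_min ?lexx//; lra.
  have me : m <= 1 / (3 * (b + 1) * C) by rewrite ge_min lexx orbT.
  pose k := (m / `|h|) *: h.
  have km : `|k| = m by rewrite normrZ ger0_norm ?divr_ge0 ?ltW// mulfVK ?gt_eqF.
  have [k1 k2 k3] := dP k ltac:(by rewrite /= km).
  rewrite k2 addrC addKr in k3.
  rewrite /k s0 LZ Lh0 scaler0 !subr0 -/k mul1r in k1.
  have := ler_normB (sigma (u0 + k) - B k k) (- B k k).
  rewrite opprK subrK => k4.
  have k5 := Bb k k.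
  rewrite normrN in k4.
  rewrite km in k1 k3 k5.
  move: (le_trans k4 (lerD k1 k5)) => k6.
  have := le_trans k3 (ler_wpM2l (ltW C0) k6).
  rewrite -mulrA -expr2 -[X in X + _]mul1r -mulrDl expr2 !mulrA -{1}[m]mul1r.
  rewrite ler_pM2r// => k7.
  have Cb0 : 0 <= C * (1 + b) by rewrite mulr_ge0 ?addr_ge0 ?ltW.
  have := le_trans k7 (ler_wpM2l Cb0 me).
  have -> : C * (1 + b) * (1 / (3 * (b + 1) * C)) = 1 / 3.
    by field; rewrite gt_eqF//= gt_eqF//; lra.
  lra.
(* [F] is an injective endomorphism in finite dimension, so this is a two-sided inverse. *)
pose M := (F^-1)%VF.
have [c c0 Mc] := linear_bound (f := M) ltac:(exact: linearP).
have FM : cancel M F := lker0_lfunVK F0.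
have MF : cancel F M := lker0_lfunK F0.
have nearM (P : 'rV[R]_q -> Prop) : (\forall h \near (0 : 'rV[R]_q), P h) ->
    \forall h \near (0 : 'rV[R]_q), P (M h).
  move=> /nbhs_norm0P[d /= d0 dP]; apply/nbhs_norm0P; exists (d / c) => /=.
    by rewrite divr_gt0.
  by move=> h /= hd; apply: dP => /=; rewrite (le_lt_trans (Mc h))// mulrC -ltr_pdivlMr.
exists (F @: coordsub R q p)%VS, (fun t => sigma (u0 + M t)),
  (fun s t => B (M s) (M t)).
have ME t : t \in (F @: coordsub R q p)%VS -> M t \in coordsub R q p.
  by move=> /memv_imgP[w wE ->]; rewrite MF.
split.
  rewrite limg_dim_eq ?dim_coordsub//; apply/eqP; rewrite -subv0.
  by rewrite (eqP F0) capvSr.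
split.
- split=> [u k v w|v k u w]; rewrite linearP; [exact: lB.1|exact: lB.2].
- move=> e e0; have e1 : 0 < e / c ^+ 2 by rewrite divr_gt0 ?exprn_gt0.
  have := nearM _ (sE _ e1); apply: filterS => h hE _.
  rewrite s0 subr0 in hE; have Lh : L (M h) = h by rewrite -FE FM.
  rewrite Lh in hE; apply: (le_trans hE).
  rewrite -mulrA ler_pM2l// mulrC ler_pdivrMr ?exprn_gt0// mulrC -exprMn.
  by rewrite lerXn2r ?nnegrE ?mulr_ge0// ltW.
- have := nearM _ sS; apply: filterS => h hE /ME; exact: hE.
(* The parameter of [v] is [F (phi v - u0)]; [a] bounds [F] and [C] is the Lipschitz constant of
   [phi] at 0. *)
- exists (a * C); first by rewrite mulr_gt0.
  apply: filterS2 Sphi phi_lip => v Sv vC S0v; have [pv spv] := Sv S0v.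
  exists (F (phi v - u0)); split; first exact: memv_img.
    by rewrite FE (le_trans (La _))// -mulrA ler_pM2l.
  by rewrite MF addrC subrK.
Unshelve. all: by end_near. Qed.

(** * Charts moved to the unit by left translation *)

Lemma lexp0 (R : realType) (q : nat) (G : groupType) (L : exp_lie_group R q G) :
  lexp L 0 = 1%g.
Proof.
have := lexpD L 0 0 0; rewrite addr0 scaler0 => e.
by apply: (mulgI (lexp L 0)); rewrite -e mulg1.
Qed.

(** In the chart, a left translation is the group law with its first argument frozen, and its
    derivative along [e] is that of the group law along [(0, e)]; smoothness of order 2 of the group
    law then gives both claims. *)
Lemma left_diff (R : realType) (q : nat) (G : groupType)
    (L : exp_lie_group R q G) (a : G) :
  (forall v, differentiable (fun v : 'rV[R]_q => llog L (a * lexp L v)%g) v) /\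
  (forall e v, differentiable ('D_e (fun v : 'rV[R]_q => llog L (a * lexp L v)%g)) v).
Proof.
pose m (w : 'rV[R]_q * 'rV[R]_q) : 'rV[R]_q := llog L (lexp L w.1 * lexp L w.2)%g.
pose P (v : 'rV[R]_q) := (llog L a, v).
have -> : (fun v => llog L (a * lexp L v)%g) = m \o P.
  by apply/funext => v; rewrite /m /P /= llogK.
have [dm ddm] := lmul_smooth L 2.
have dP v : is_diff v P (fun h : 'rV[R]_q => (0, h)).
  exact: (is_diff_pair (is_diff_cst (llog L a) v) (is_diff_id v)).
have dmP v : differentiable (m \o P) v.
  by apply: differentiable_comp; [exact: ex_diff|exact: dm].
split=> // e v.
have -> : 'D_e (m \o P) = 'D_((0, e) : 'rV[R]_q * 'rV[R]_q) m \o P.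
  apply/funext => w; rewrite deriveE// diff_comp; [|exact: ex_diff|exact: dm].
  rewrite /= deriveE; last exact: dm.
  by rewrite diff_val.
apply: differentiable_comp; first exact: ex_diff.
by have [+ _] := ddm (0, e); apply.
Qed.

(** The straightening chart at [x] is carried to the unit: [tau \o Psi] serves as the inverse chart
    and [Phi \o tau'] as the chart, where [tau] and [tau'] are the mutually inverse translations by
    [x^-1] and [x]. *)
Lemma submanifold_param2 (R : realType) (q : nat) (G : groupType)
    (L : exp_lie_group R q G) (p : nat) (Sigma : set G) (x : G) :
  C2_submanifold L p Sigma -> Sigma x ->
  exists T s B, \dim T = p /\ param2 [set v | Sigma (x * lexp L v)%g] T s B.
Proof.
move=> [pq ch] Sx; have [U [N [Phi [Psi]]]] := ch x Sx.
move=> [[oU oN Ux] [UN PsiK] [NU PhiK] [[dPhi _] [dPsi ddPsi]] SPhi].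
pose tau v := llog L (x^-1 * lexp L v)%g.
pose tau' v := llog L (x * lexp L v)%g.
have tauK v : tau' (tau v) = v by rewrite /tau /tau' llogK mulVKg lexpK.
have tau'K v : tau (tau' v) = v by rewrite /tau /tau' llogK mulKg lexpK.
have [dtau ddtau] := left_diff L x^-1.
have [dtau' _] := left_diff L x.
have tau'0 : tau' 0 = llog L x by rewrite /tau' lexp0 mulg1.
have taux : tau (llog L x) = 0 by rewrite -tau'0 tau'K.
set u0 := Phi (llog L x).
have Nu0 : N u0 by exact: UN.
have Psiu0 : Psi u0 = llog L x by rewrite PsiK.
have [L1 [B1 [l1 lB1 E1]]] : exists L1 B1,
    [/\ linear L1, bilin B1 & expand2 Psi u0 L1 B1].
  apply: taylor2 => [|i].
    by have := open_nbhs_nbhs (conj oN Nu0); apply: filterS => y; exact: dPsi.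
  by have [+ _] := ddPsi (delta_mx 0 i); apply.
have [L2 [B2 [l2 lB2 E2]]] : exists L2 B2,
    [/\ linear L2, bilin B2 & expand2 tau (Psi u0) L2 B2].
  apply: taylor2 => [|i]; last exact: ddtau.
  by apply: filterS (filterT : nbhs (Psi u0) setT) => y _; exact: dtau.
have E := expand2_comp l1 lB1 l2 lB2 E1 E2.
have u0p (i : 'I_q) : (p <= i)%N -> u0 0 i = 0.
  by move: i; apply/SPhi => //; rewrite llogK.
have tau'U : \forall v \near (0 : 'rV[R]_q), U (tau' v).
  apply: (differentiable_continuous (dtau' 0)).
  by rewrite /= -/(tau' 0) tau'0; exact: open_nbhs_nbhs.
have dphi : differentiable (Phi \o tau') 0.
  apply: differentiable_comp; first exact: dtau'.
  by apply: dPhi; rewrite tau'0.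
have [C C0 phiC] := diff_lip dphi.
apply: (param2_chart (phi := Phi \o tau') pq _ _ E _ _ _ _ C0) => //.
- exact: linear_comp.
- exact: bilin_comp.
- by rewrite /= Psiu0.
- have := near_openD oN Nu0; apply: filterS => h Nh /mem_coordsub hp.
  rewrite /= /tau llogK mulVKg; apply/SPhi; first exact: NU.
  by move=> i pi; rewrite PhiK// mxE u0p// hp// addr0.
- apply: filterS tau'U => v Uv Sv; split; last by rewrite /= PsiK// tau'K.
  apply/mem_coordsub => i pi; rewrite !mxE u0p// subr0 /=.
  by move: i pi; apply/SPhi => //; rewrite /tau' llogK.
- have := near_openD oN Nu0; apply: filterS => h Nh.
  by rewrite /= tauK PhiK.
- by move: phiC; apply: filterS => h; rewrite add0r /= tau'0.
Qed.

(** * Dilations and the tangent cone *)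

(** A left inverse of [f] on [U], where [f] is injective: [f] is precomposed with the projection
    onto [U], a generalized inverse is applied, and the result is projected back into [U]. *)
Lemma lfun_inv_on (K : fieldType) (vT : vectType K) (f : 'End(vT))
    (U : {vspace vT}) : (U :&: lker f = 0)%VS ->
  exists g : 'End(vT), forall v, v \in U -> g (f v) = v.
Proof.
move=> Uf; have [h hE] : exists h : 'End(vT), forall v, h v = f (projv U v).
  by exists (f \o projv U)%VF => v; rewrite comp_lfunE.
exists (projv U \o h^-1)%VF => v vU; rewrite comp_lfunE /=.
have hv : h v = f v by rewrite hE projv_id.
have : h (h^-1%VF (h v)) = h v by rewrite limg_lfunVK// memv_img// memvf.
rewrite hE hv => pw; apply/eqP; rewrite -subr_eq0 -memv0 -Uf memv_cap.
by rewrite memvB ?memv_proj//= memv_ker linearB /= pw subrr eqxx.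
Qed.

(** The formula of [dil] in terms of the two subspaces alone, so that the blow-up takes place in the
    vector space, away from the group. *)
Definition dilv (R : realType) (q : nat) (U W : {vspace 'rV[R]_q}) (r : R)
    (v : 'rV[R]_q) : 'rV[R]_q :=
  r *: daddv_pi U W v + r ^+ 2 *: daddv_pi W U v.

Section Blowup.
Context (R : realType) (q : nat) (V1 V2 : {vspace 'rV[R]_q}).
Hypotheses (V12 : (V1 :&: V2 = 0)%VS) (V12f : (V1 + V2 = fullv)%VS).

Let V21 : (V2 :&: V1 = 0)%VS. Proof. by rewrite capvC. Qed.

Local Notation pi1 := (daddv_pi V1 V2).
Local Notation pi2 := (daddv_pi V2 V1).
Local Notation dilat := (dilv V1 V2).

Lemma pi12 v : pi1 v + pi2 v = v.
Proof. by apply: daddv_pi_add V12 _; rewrite V12f memvf. Qed.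

Lemma pi1_id v : v \in V1 -> pi1 v = v.
Proof. exact: daddv_pi_id. Qed.

Lemma pi2_id v : v \in V2 -> pi2 v = v.
Proof. exact: daddv_pi_id. Qed.

Lemma pi2_0 v : v \in V1 -> pi2 v = 0.
Proof. by move=> v1; apply: (addrI (pi1 v)); rewrite pi12 pi1_id// addr0. Qed.

Lemma pi1_0 v : v \in V2 -> pi1 v = 0.
Proof. by move=> v2; apply: (addIr (pi2 v)); rewrite pi12 pi2_id// add0r. Qed.

Lemma pi1_in v : pi1 v \in V1. Proof. exact: memv_pi. Qed.
Lemma pi2_in v : pi2 v \in V2. Proof. exact: memv_pi. Qed.

Lemma pi1_dil r v : pi1 (dilat r v) = r *: pi1 v.
Proof.
by rewrite /dilv linearD !linearZ /= (pi1_id (pi1_in _)) (pi1_0 (pi2_in _))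
  scaler0 addr0.
Qed.

Lemma pi2_dil r v : pi2 (dilat r v) = r ^+ 2 *: pi2 v.
Proof.
by rewrite /dilv linearD !linearZ /= (pi2_id (pi2_in _)) (pi2_0 (pi1_in _))
  scaler0 add0r.
Qed.

Lemma dilM r s v : dilat r (dilat s v) = dilat (r * s) v.
Proof. by rewrite {1}/dilv pi1_dil pi2_dil !scalerA -exprMn. Qed.

Lemma dil1 v : dilat 1 v = v.
Proof. by rewrite /dilv expr1n !scale1r pi12. Qed.

Lemma dilK r v : r != 0 -> dilat r (dilat r^-1 v) = v.
Proof. by move=> r0; rewrite dilM mulfV// dil1. Qed.

Lemma dilVK r v : r != 0 -> dilat r^-1 (dilat r v) = v.
Proof. by move=> r0; rewrite dilM mulVf// dil1. Qed.

Lemma pi_bound : exists2 P, 0 < P &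
  (forall v, `|pi1 v| <= P * `|v|) /\ (forall v, `|pi2 v| <= P * `|v|).
Proof.
have [a a0 Ha] := linear_bound (f := pi1) ltac:(exact: linearP).
have [b b0 Hb] := linear_bound (f := pi2) ltac:(exact: linearP).
exists (a + b); first by rewrite addr_gt0.
by split=> v; [apply: le_trans (Ha v) _|apply: le_trans (Hb v) _];
  rewrite ler_wpM2r// ?lerDl ?lerDr ltW.
Qed.

(** * Horizontal part of the tangent space and a complement of it *)

Context (T : {vspace 'rV[R]_q}).

Definition horT : {vspace 'rV[R]_q} := (T :&: V1)%VS.
(** On subspaces [:\:] is not a set difference: it is a chosen complement of [T :&: V1] in [T]. *)
Definition verT : {vspace 'rV[R]_q} := (T :\: V1)%VS.

Lemma horT_verT_split t : t \in T -> exists a b, [/\ a \in horT, b \in verT & t = a + b].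
Proof.
rewrite -{1}(addv_diff_cap T V1) => /memv_addP[b bv [a av ->]].
by exists a, b; rewrite addrC.
Qed.

(** The kernel of [pi2] is [V1], which meets the complement [verT] trivially. *)
Lemma verT_inj : (verT :&: lker pi2 = 0)%VS.
Proof.
apply/eqP; rewrite -subv0 -(capv_diff T V1) -/verT.
apply/subvP => v; rewrite !memv_cap memv_ker => /andP[-> /eqP pv]/=.
by rewrite -[v]pi12 pv addr0 pi1_in.
Qed.

(** A vector of [verT] is controlled by its [V2] component; this is what forces the vertical
    parameter of a point of homogeneous size [r] to have size [r ^+ 2]. *)
Lemma verT_bound : exists2 C, 0 < C & forall v, v \in verT -> `|v| <= C * `|pi2 v|.
Proof.
have [g gP] := lfun_inv_on verT_inj.
have [C C0 gC] := linear_bound (f := g) ltac:(exact: linearP).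
by exists C => // v vT; rewrite -{1}(gP _ vT) gC.
Qed.

(** * Blow-up of the parametrized set *)

Context (S0 : set 'rV[R]_q) (s : 'rV[R]_q -> 'rV[R]_q)
  (B : 'rV[R]_q -> 'rV[R]_q -> 'rV[R]_q).
Hypothesis sP : param2 S0 T s B.

(* The limit of [dilat r^-1 (s (r *: a + r ^+ 2 *: b))] as r tends to 0. *)
Definition conept (a b : 'rV[R]_q) : 'rV[R]_q := a + pi2 b + pi2 (B a a).

Definition cone : set 'rV[R]_q :=
  [set v | exists a b, [/\ a \in horT, b \in verT & v = conept a b]].

Let bilB : bilin B. Proof. by case: sP. Qed.

Lemma horT_V1 a : a \in horT -> a \in V1.
Proof. by rewrite memv_cap => /andP[]. Qed.

Lemma horT_T a : a \in horT -> a \in T.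
Proof. by rewrite memv_cap => /andP[]. Qed.

Lemma verT_T a : a \in verT -> a \in T.
Proof. by apply: subvP; exact: diffvSl. Qed.

Lemma pi1_conept a b : a \in horT -> pi1 (conept a b) = a.
Proof.
move=> aT; rewrite /conept !linearD /= (pi1_0 (pi2_in _)) (pi1_0 (pi2_in _)).
by rewrite !addr0 pi1_id// horT_V1.
Qed.

Lemma pi2_conept a b : a \in horT -> pi2 (conept a b) = pi2 b + pi2 (B a a).
Proof.
move=> aT; rewrite /conept !linearD /= (pi2_id (pi2_in _)) (pi2_id (pi2_in _)).
by rewrite pi2_0 ?add0r// horT_V1.
Qed.

Lemma cone_dil r v : cone v -> cone (dilat r v).
Proof.
move=> [a [b [aT bT ->]]]; exists (r *: a), (r ^+ 2 *: b).
have [_ _ _ _ Z1] := linearDZ (bilB.1 (r *: a)).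
have [_ _ _ _ Z2] := linearDZ (bilB.2 a).
split; [exact: memvZ|exact: memvZ|].
rewrite /dilv pi1_conept// pi2_conept// /conept Z1 Z2 scalerA -expr2 !linearZ /=.
by rewrite scalerDr addrA.
Qed.

(** Put [u = r *: a + r ^+ 2 *: b], so that [s u] is [u + B u u] up to [o(r ^+ 2)]. In [V1] one
    divides by [r] and only [a] survives. In [V2] one divides by [r ^+ 2]: as [pi2 a = 0], what
    survives is [pi2 b] from [u] and [pi2 (B a a)] from [B u u]. *)
Lemma conept_approx N e : 0 < N -> 0 < e -> exists2 r0, 0 < r0 &
  forall r a b z, 0 < r < r0 -> a \in horT -> b \in verT ->
    `|a| <= N -> `|b| <= N -> dilat r z = s (r *: a + r ^+ 2 *: b) ->
    `|z - conept a b| <= e.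
Proof.
move=> N0 e0.
have [P P0 [P1 P2]] := pi_bound.
have [D D0 BD] := bilin_bound bilB.
(* In the final estimate [K1] is the coefficient of [r] and [K2] that of [eps]; the choices of [eps]
   and of the bound on [r] make each product at most [e / 2]. *)
pose K1 := P * (4 * N ^+ 2 + N + 4 * D * N ^+ 2 + 3 * D * N ^+ 2).
pose K2 := 4 * P * N ^+ 2.
have N20 : 0 < N ^+ 2 by rewrite exprn_gt0.
have DN0 : 0 < D * N ^+ 2 by rewrite mulr_gt0.
have K10 : 0 < K1 by rewrite /K1 mulr_gt0//; lra.
have K20 : 0 < K2 by rewrite /K2 !mulr_gt0.
pose eps := Num.min 1 (e / (2 * K2)).
have eps0 : 0 < eps by rewrite lt_min ltr01 divr_gt0// mulr_gt0.
have eps1 : eps <= 1 by rewrite /eps ge_min lexx.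
have [_ /(_ eps eps0) /nbhs_norm0P[d /= d0 dP] _ _] := sP.
exists (Num.min 1 (Num.min (d / (2 * N)) (e / (2 * K1)))).
  by rewrite !lt_min ltr01 !divr_gt0// mulr_gt0.
move=> r a b z /andP[r0]; rewrite !lt_min => /and3P[r1 rd re] aT bT aN bN zE.
have [u uE] : exists u, u = r *: a + r ^+ 2 *: b by eexists.
rewrite -uE in zE.
have r20 : 0 < r ^+ 2 by rewrite exprn_gt0.
have r2r : r ^+ 2 <= r by rewrite expr2 ler_piMr// ltW.
have [r0' r20' N0' D0' P0'] : [/\ 0 <= r, 0 <= r ^+ 2, 0 <= N, 0 <= D & 0 <= P].
  by split; exact: ltW.
have uN : `|u| <= 2 * r * N.
  rewrite uE (le_trans (ler_normD _ _))// (normrZ r) (normrZ (r ^+ 2)) !ger0_norm//.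
  have := ler_pM (ltW r0) (normr_ge0 _) (lexx r) aN.
  have := ler_pM (ltW r20) (normr_ge0 _) r2r bN; lra.
have uT : u \in T.
  by rewrite uE; apply: memvD; apply: memvZ; [exact: horT_T|exact: verT_T].
have ud : `|u| < d.
  by move: rd; rewrite ltr_pdivlMr ?mulr_gt0// => rd; move: uN rd; lra.
have [E EE] : exists E, E = s u - u - B u u by eexists.
have Ele : `|E| <= eps * `|u| ^+ 2 by rewrite EE; exact: dP.
have Er : `|E| <= eps * (4 * r ^+ 2 * N ^+ 2).
  apply: (le_trans Ele); rewrite ler_pM2l//.
  have -> : 4 * r ^+ 2 * N ^+ 2 = (2 * r * N) ^+ 2 by ring.
  by rewrite lerXn2r ?nnegrE// !mulr_ge0.
have BuD : `|B u u| <= 4 * D * N ^+ 2 * r ^+ 2.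
  apply: (le_trans (BD _ _)).
  have -> : 4 * D * N ^+ 2 * r ^+ 2 = D * (2 * r * N) * (2 * r * N) by ring.
  by rewrite !ler_pM ?mulr_ge0.
have sE : s u = E + u + B u u by rewrite EE -addrA (addrC u) addrA !subrK.
have z1 : `|pi1 z - a| <= r * (P * (4 * N ^+ 2 + N + 4 * D * N ^+ 2)).
  have : r *: (pi1 z - a) = pi1 (E + r ^+ 2 *: b + B u u).
    have pu : pi1 u = r *: a + r ^+ 2 *: pi1 b.
      by rewrite uE linearD !linearZ /= (pi1_id (horT_V1 aT)).
    have sEp : pi1 (s u) = pi1 E + (r *: a + r ^+ 2 *: pi1 b) + pi1 (B u u).
      by rewrite sE linearD /= linearD /= pu.
    have -> : pi1 (E + r ^+ 2 *: b + B u u) = pi1 E + r ^+ 2 *: pi1 b + pi1 (B u u).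
      by rewrite linearD /= linearD /= linearZ.
    rewrite scalerBr -(pi1_dil r z) zE sEp.
    set x := pi1 E; set y := pi1 (B u u).
    by apply/rowP => i; rewrite !mxE; ring.
  move=> /(congr1 Num.Def.normr); rewrite normrZ gtr0_norm// => zE1.
  rewrite -(ler_pM2l r0) zE1 (le_trans (P1 _))//.
  have -> : r * (r * (P * (4 * N ^+ 2 + N + 4 * D * N ^+ 2))) =
    P * (4 * r ^+ 2 * N ^+ 2 + r ^+ 2 * N + 4 * D * N ^+ 2 * r ^+ 2) by ring.
  rewrite ler_pM2l// (le_trans (ler_normD _ _))// lerD//.
  rewrite (le_trans (ler_normD _ _))// lerD//.
    by apply: (le_trans Er); apply: ler_piMl => //; rewrite !mulr_ge0.
  by rewrite normrZ gtr0_norm// ler_pM2l.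
have [B1 B2] := bilB.
(* Beyond [B a a], the bilinear expansion leaves only terms with a factor [r ^+ 3], which still
   vanish after division by [r ^+ 2]. *)
have BE : B u u - r ^+ 2 *: B a a = r ^+ 3 *: (B a b + B b a + r *: B b b).
  have [_ uD _ _ uZ] := linearDZ (B1 u).
  have [_ aD _ _ aZ] := linearDZ (B2 a).
  have [_ bD _ _ bZ] := linearDZ (B2 b).
  have -> : B u u = r *: B u a + r ^+ 2 *: B u b by rewrite {2}uE uD !uZ.
  have -> : B u a = r *: B a a + r ^+ 2 *: B b a.
    by rewrite uE (aD (r *: a) (r ^+ 2 *: b)) (aZ r a) (aZ (r ^+ 2) b).
  have -> : B u b = r *: B a b + r ^+ 2 *: B b b.
    by rewrite uE (bD (r *: a) (r ^+ 2 *: b)) (bZ r a) (bZ (r ^+ 2) b).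
  by apply/rowP => i; rewrite !mxE; ring.
have BEle : `|B u u - r ^+ 2 *: B a a| <= r ^+ 2 * (3 * r * D * N ^+ 2).
  have BN x y : `|x| <= N -> `|y| <= N -> `|B x y| <= D * N ^+ 2.
    move=> xN yN; apply: (le_trans (BD _ _)); rewrite expr2 mulrA.
    by rewrite !ler_pM ?mulr_ge0.
  rewrite BE normrZ gtr0_norm ?exprn_gt0//.
  have -> : r ^+ 2 * (3 * r * D * N ^+ 2) =
    r ^+ 3 * (D * N ^+ 2 + D * N ^+ 2 + D * N ^+ 2) by ring.
  rewrite ler_pM2l ?exprn_gt0// (le_trans (ler_normD _ _))// lerD//.
    by rewrite (le_trans (ler_normD _ _))// lerD// BN.
  rewrite normrZ gtr0_norm// (le_trans _ (BN _ _ bN bN))// ler_piMl// ltW//.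
have z2 : `|pi2 z - (pi2 b + pi2 (B a a))| <=
    P * (4 * N ^+ 2 * eps + 3 * r * D * N ^+ 2).
  have : r ^+ 2 *: (pi2 z - (pi2 b + pi2 (B a a))) =
      pi2 (E + (B u u - r ^+ 2 *: B a a)).
    have pu : pi2 u = r ^+ 2 *: pi2 b.
      by rewrite uE linearD !linearZ /= (pi2_0 (horT_V1 aT)) scaler0 add0r.
    have sEp : pi2 (s u) = pi2 E + r ^+ 2 *: pi2 b + pi2 (B u u).
      by rewrite sE linearD /= linearD /= pu.
    have -> : pi2 (E + (B u u - r ^+ 2 *: B a a)) =
        pi2 E + (pi2 (B u u) - r ^+ 2 *: pi2 (B a a)).
      by rewrite linearD /= linearB /= linearZ.
    rewrite scalerBr -(pi2_dil r z) zE sEp.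
    set x := pi2 E; set y := pi2 (B u u).
    by apply/rowP => i; rewrite !mxE; ring.
  move=> /(congr1 Num.Def.normr); rewrite normrZ gtr0_norm// => zE2.
  rewrite -(ler_pM2l r20) zE2 (le_trans (P2 _))//.
  rewrite mulrCA ler_pM2l// mulrDr (le_trans (ler_normD _ _))// lerD//.
  by apply: (le_trans Er); rewrite le_eqVlt; apply/orP; left; apply/eqP; ring.
have -> : z - conept a b = (pi1 z - a) + (pi2 z - (pi2 b + pi2 (B a a))).
  by rewrite /conept -{1}(pi12 z); apply/rowP => i; rewrite !mxE; ring.
rewrite (le_trans (ler_normD _ _))// (le_trans (lerD z1 z2))//.
have -> : r * (P * (4 * N ^+ 2 + N + 4 * D * N ^+ 2)) +
  P * (4 * N ^+ 2 * eps + 3 * r * D * N ^+ 2) = r * K1 + eps * K2.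
  by rewrite /K1 /K2; ring.
have : r * K1 <= e / 2.
  by move: re; rewrite ltr_pdivlMr ?mulr_gt0//; lra.
have : eps * K2 <= e / 2.
  have : eps <= e / (2 * K2) by rewrite /eps ge_min lexx orbT.
  by rewrite ler_pdivlMr ?mulr_gt0//; lra.
lra.
Qed.

(** The point [dilat r z] has norm O(r), hence so does its parameter [t = a + b]. Its [V2] component
    is O(r^2) and differs from [pi2 t = pi2 b] by O(|t|^2), so [b] is O(r^2). Thus [r^-1 *: a] and
    [r ^- 2 *: b] are bounded and [conept_approx] applies. *)
Lemma rescaled_near_cone M e : 0 < M -> 0 < e -> exists2 r0, 0 < r0 &
  forall r z, 0 < r < r0 -> `|z| <= M -> S0 (dilat r z) ->
    exists2 c, cone c & `|z - c| <= e.
Proof.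
move=> M0 e0.
have [P P0 [P1 P2]] := pi_bound.
have [D D0 BD] := bilin_bound bilB.
have [A A0 vA] := verT_bound.
have [_ /(_ 1 ltr01) /nbhs_norm0P[d /= d0 dP] _ [C C0]] := sP.
move=> /nbhs_norm0P[d' /= d'0 sv].
have [[M' P'] [D' A' C']] : (0 <= M /\ 0 <= P) /\ [/\ 0 <= D, 0 <= A & 0 <= C].
  by split; split; exact: ltW.
(* [Q] will bound [|t| / r] and [N1] will bound [|b| / r ^+ 2]; in [N1], the [1] stands for the
   remainder of [s] and [D] for [B t t]. *)
pose Q := 2 * C * P * M.
pose N1 := A * (P * M + P * (1 + D) * Q ^+ 2).
have Q0 : 0 < Q by rewrite /Q !mulr_gt0.
have N10 : 0 < N1 by rewrite /N1 mulr_gt0// addr_gt0 ?mulr_gt0 ?addr_gt0 ?exprn_gt0.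
have [r0 r00 rP] := conept_approx (addr_gt0 Q0 N10) e0.
exists (Num.min r0 (Num.min 1 (Num.min (d' / (2 * P * M)) (d / Q)))).
  by rewrite !lt_min r00 ltr01 !divr_gt0// !mulr_gt0.
move=> r z /andP[rr]; rewrite !lt_min => /and4P[rr0 r1 rd' rd] zM Sz.
have r20 : 0 < r ^+ 2 by rewrite exprn_gt0.
have r2r : r ^+ 2 <= r by rewrite expr2 ler_piMr// ltW.
have [r' r2'] : 0 <= r /\ 0 <= r ^+ 2 by split; exact: ltW.
rewrite ltr_pdivlMr ?mulr_gt0// in rd'; rewrite ltr_pdivlMr// in rd.
have pzM (p : 'End('rV[R]_q)) : (forall v, `|p v| <= P * `|v|) -> `|p z| <= P * M.
  by move=> pP; rewrite (le_trans (pP z))// ler_pM2l.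
have vM : `|dilat r z| <= r * (2 * P * M).
  rewrite /dilv (le_trans (ler_normD _ _))// (normrZ r) (normrZ (r ^+ 2)) !ger0_norm//.
  have := ler_pM r' (normr_ge0 _) (lexx r) (pzM _ P1).
  have := ler_pM r2' (normr_ge0 _) r2r (pzM _ P2); lra.
have [t [tT tC st]] := sv (dilat r z) (le_lt_trans vM rd') Sz.
have tQ : `|t| <= r * Q.
  rewrite (le_trans tC)//; have -> : r * Q = C * (r * (2 * P * M)) by rewrite /Q; ring.
  by rewrite ler_pM2l.
have tE := dP t (le_lt_trans tQ rd) tT; rewrite st mul1r in tE.
have [a [b [aT bT tab]]] := horT_verT_split tT.
have p2t : pi2 t = pi2 b by rewrite tab linearD /= (pi2_0 (horT_V1 aT)) add0r.
have bN : `|b| <= r ^+ 2 * N1.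
  rewrite (le_trans (vA b bT))// /N1 mulrCA ler_pM2l// -p2t.
  have -> : pi2 t = pi2 (dilat r z) - pi2 ((dilat r z - t - B t t) + B t t).
    by rewrite subrK linearB /= opprB addrC subrK.
  rewrite (le_trans (ler_normB _ _))// pi2_dil normrZ gtr0_norm// mulrDr lerD//.
    by rewrite ler_pM2l// pzM.
  rewrite (le_trans (P2 _))// -mulrA mulrCA ler_pM2l// (le_trans (ler_normD _ _))//.
  have tt : `|t| ^+ 2 <= r ^+ 2 * Q ^+ 2.
    by rewrite -exprMn lerXn2r ?nnegrE// mulr_ge0// ltW.
  have := le_trans tE tt; have := BD t t; rewrite -mulrA -expr2 => Btt.
  have := le_trans Btt (ler_wpM2l D' tt); lra.
have aN : `|a| <= r * (Q + N1).
  have -> : a = t - b by rewrite tab addrK.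
  rewrite (le_trans (ler_normB _ _))// mulrDr lerD// (le_trans bN)//.
  by rewrite ler_pM2r.
exists (conept (r^-1 *: a) (r ^- 2 *: b)).
  by exists (r^-1 *: a), (r ^- 2 *: b); split=> //; apply: memvZ.
apply: (rP r) => //.
- by rewrite rr.
- exact: memvZ.
- exact: memvZ.
- by rewrite normrZ normfV gtr0_norm// ler_pdivrMl.
- rewrite normrZ normfV gtr0_norm// ler_pdivrMl// (le_trans bN)// ler_pM2l// lerDr.
  exact: ltW.
- by rewrite !scalerA divff ?gt_eqF// divff ?gt_eqF// !scale1r -tab st.
Qed.

(** The parameters of a bounded cone point are bounded, since [a] is its [V1] component and [pi2 b]
    is then read off its [V2] component. The approximating point is the rescaled image under [s] of
    [r *: a + r ^+ 2 *: b]. *)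
Lemma cone_near_rescaled M e : 0 < M -> 0 < e -> exists2 r0, 0 < r0 &
  forall r c, 0 < r < r0 -> cone c -> `|c| <= M ->
    exists2 z, S0 (dilat r z) & `|z - c| <= e.
Proof.
move=> M0 e0.
have [P P0 [P1 P2]] := pi_bound.
have [D D0 BD] := bilin_bound bilB.
have [A A0 vA] := verT_bound.
have [_ _ /nbhs_norm0P[d /= d0 dP] _] := sP.
pose N1 := P * M; pose N2 := A * (P * M + P * (D * N1 * N1)).
have N10 : 0 < N1 by rewrite mulr_gt0.
have N20 : 0 < N2 by rewrite /N2 mulr_gt0// addr_gt0 ?mulr_gt0.
have N0 : 0 < N1 + N2 by rewrite addr_gt0.
have [r0 r00 rP] := conept_approx N0 e0.
exists (Num.min r0 (Num.min 1 (d / (2 * (N1 + N2))))).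
  by rewrite !lt_min r00 ltr01 divr_gt0// mulr_gt0.
move=> r c /andP[rr]; rewrite !lt_min => /and3P[rr0 r1 rd] [a [b [aT bT cE]]] cM.
have r20 : 0 < r ^+ 2 by rewrite exprn_gt0.
have r2r : r ^+ 2 <= r by rewrite expr2 ler_piMr// ltW.
have [r' r2' D'] : [/\ 0 <= r, 0 <= r ^+ 2 & 0 <= D] by split; exact: ltW.
rewrite ltr_pdivlMr ?mulr_gt0// in rd.
have aN : `|a| <= N1.
  by rewrite -(pi1_conept b aT) -cE (le_trans (P1 _))// ler_pM2l.
have bN : `|b| <= N2.
  rewrite (le_trans (vA b bT))// ler_pM2l//.
  have -> : pi2 b = pi2 c - pi2 (B a a) by rewrite cE pi2_conept// addrK.
  rewrite (le_trans (ler_normB _ _))// lerD// (le_trans (P2 _))// ler_pM2l//.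
  by rewrite (le_trans (BD _ _))// !ler_pM ?mulr_ge0.
have aN' : `|a| <= N1 + N2 by rewrite (le_trans aN)// lerDl ltW.
have bN' : `|b| <= N1 + N2 by rewrite (le_trans bN)// lerDr ltW.
exists (dilat r^-1 (s (r *: a + r ^+ 2 *: b))).
  rewrite dilK ?gt_eqF//; apply: dP => /=; last first.
    by apply: memvD; apply: memvZ; [exact: horT_T|exact: verT_T].
  apply: le_lt_trans rd.
  rewrite (le_trans (ler_normD _ _))// (normrZ r) (normrZ (r ^+ 2)) !ger0_norm//.
  have := ler_pM r' (normr_ge0 _) (lexx r) aN'.
  have := ler_pM r2' (normr_ge0 _) r2r bN'; lra.
rewrite cE; apply: (rP r) => //; first by rewrite rr.
by rewrite dilK ?gt_eqF.
Qed.

End Blowup.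

(** * Homogeneous distances and Hausdorff convergence *)

Lemma linear_rV_continuous (R : realType) n (W : normedModType R)
    (f : 'rV[R]_n -> W) : linear f -> continuous f.
Proof.
move=> lf v; have [C C0 fC] := linear_bound lf.
have [_ _ _ fB _] := linearDZ lf.
have FF : Filter (nbhs (v : 'rV[R]_n)) := nbhs_filter v.
apply/(@cvgrPdist_lt _ W _ (nbhs (v : 'rV[R]_n)) FF) => e e0.
apply/(@nbhs_normP _ 'rV[R]_n v); exists (e / C) => /= [|w /= vw].
  by rewrite divr_gt0.
by rewrite -fB (le_lt_trans (fC _))// mulrC -ltr_pdivlMr.
Qed.

Lemma rV_cball_compact (R : realType) n (M : R) :
  compact [set v : 'rV[R]_n | `|v| <= M].
Proof.
apply: bounded_closed_compact.
  exists M; split; first exact: num_real.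
  by move=> N MN v /= vM; rewrite (le_trans vM)// ltW.
rewrite (_ : [set v | _] = (fun v : 'rV[R]_n => `|v|) @^-1` [set t | t <= M])//.
by apply: closed_comp; [move=> v _; exact: norm_continuous|exact: closed_le].
Qed.

Section Distance.
Context (R : realType) (q : nat) (G : groupType) (S : two_step_group R q G).
Context (rho : G -> G -> R) (hrho : homogeneous_distance S rho).

Local Notation pi1 := (daddv_pi (V1 S) (V2 S)).
Local Notation pi2 := (daddv_pi (V2 S) (V1 S)).
Local Notation dilat := (dilv (V1 S) (V2 S)).
Local Notation N v := (rho 1%g (lexp S v)).

Let V12 : (V1 S :&: V2 S = 0)%VS := V1V2_direct S.
Let V12f : (V1 S + V2 S = fullv)%VS := V1V2_full S.

Lemma rho_xx x : rho x x = 0.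
Proof. by apply/(rho_eq0 hrho). Qed.

Lemma rho_ge0 x y : 0 <= rho x y.
Proof.
have := rho_triangle hrho x y x; rewrite rho_xx (rho_sym hrho y x).
lra.
Qed.

Lemma llog1 : llog S 1%g = 0.
Proof. by rewrite -(lexp0 S) lexpK. Qed.

Lemma N_dil r v : 0 < r -> N (dilat r v) = r * N v.
Proof.
move=> r0; have := rho_dil hrho 1%g (lexp S v) r0.
rewrite /gdil llog1 lexpK => <-; congr rho.
by rewrite /dil !linear0 ?scaler0 addr0 lexp0.
Qed.

(** Continuity of [rho] on the diagonal, where it vanishes, made uniform by compactness of the ball;
    only [v] is confined to that ball. *)
Lemma rho_unif M e : 0 < e -> exists2 d, 0 < d &
  forall v w, `|v| <= M -> `|v - w| < d -> rho (lexp S v) (lexp S w) <= e.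
Proof.
move=> e0; have cmp := @rV_cball_compact R q M.
have cov (v0 : 'rV[R]_q) : `|v0| <= M -> \forall v \near (v0 : 'rV[R]_q) & d \near 0^'+,
    forall w, `|v - w| < d -> rho (lexp S v) (lexp S w) <= e.
  move=> _; have := @rho_continuous _ _ _ _ _ hrho (v0, v0).
  move=> /cvgrPdist_lt/(_ e e0).
  rewrite /= rho_xx => /nbhs_normP[d /= d0 dP].
  near=> v d1 => w vw.
  have := dP (v, w); rewrite /ball_ /= sub0r normrN ger0_norm ?rho_ge0// => /(_ _)/ltW.
  apply; rewrite prod_normE /= gt_max; apply/andP; split.
    by near: v; exact: (@cvgr_dist_lt _ 'rV[R]_q).
  have d1d : d1 < d / 2 by near: d1; apply: nbhs_right_lt; rewrite divr_gt0.
  have vd : `|v0 - v| < d / 2.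
    by near: v; apply: (@cvgr_dist_lt _ 'rV[R]_q) => //; rewrite divr_gt0.
  rewrite -[v0 - w](subrKA v) (le_lt_trans (ler_normD _ _))//.
  move: (lt_trans vw d1d) vd; lra.
have H := (compact_near_coveringP _).1 cmp R (at_right (0 : R)) _ _ cov.
have [d [d0 dP]] : exists d : R, 0 < d /\ forall v, `|v| <= M ->
    forall w, `|v - w| < d -> rho (lexp S v) (lexp S w) <= e.
  near (0 : R)^'+ => d; exists d; split; first by near: d; exact: nbhs_right_gt.
  by near: d; exact: H.
by exists d => // v w vM; exact: dP.
Unshelve. all: by end_near. Qed.

Lemma N_continuous : continuous (fun v => N v).
Proof.
move=> v; have c := @rho_continuous _ _ _ _ _ hrho (0, v).
have -> : (fun v => N v) = (fun w : 'rV[R]_q * 'rV[R]_q =>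
    rho (lexp S w.1) (lexp S w.2)) \o (fun v : 'rV[R]_q => (0, v)).
  by apply/funext => w /=; rewrite lexp0.
apply: continuous_comp => //.
apply: differentiable_continuous; apply: differentiable_pair.
  exact: differentiable_cst.
exact: ex_diff.
Qed.

(** The distance to the unit has a positive minimum on a compact set [K] met by the dilation orbit
    of every nonzero vector; homogeneity then bounds the size of [v] by its distance to the unit. *)
Lemma N_bounded r : exists2 M, 0 < M & forall v, N v <= r -> `|v| <= M.
Proof.
pose g (v : 'rV[R]_q) := Num.max `|pi1 v| `|pi2 v|.
pose K := [set v | g v = 1].
have gc : continuous g.
  have pc (p : 'End('rV[R]_q)) : continuous (fun v : 'rV[R]_q => `|p v|).
    move=> v; have pl : linear p by exact: linearP.
    exact: (continuous_comp (@linear_rV_continuous _ _ _ _ pl v)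
             (@norm_continuous _ 'rV[R]_q (p v))).
  by move=> v; exact: (continuous_max (@pc pi1 v) (@pc pi2 v)).
have vg v : `|v| <= `|pi1 v| + `|pi2 v|.
  by rewrite -{1}(pi12 V12 V12f v) ler_normD.
have [c [Kc cmin]] : exists c, K c /\ forall v, K v -> N c <= N v.
  have [u uV u0] : exists2 u, u \in V1 S & u != 0.
    by exists (vpick (V1 S)); [exact: memv_pick|rewrite vpick0 V1_neq0].
  have [] := @EVT_min_rV R q (fun v => N v) K.
  - exists (`|u|^-1 *: u); rewrite /K /g /= !linearZ /=.
    rewrite (pi1_id V12 uV) (pi2_0 V12 V12f uV).
    rewrite scaler0 normr0 normrZ normfV normr_id mulVf ?normr_eq0//.
    by rewrite max_l.
  - apply: bounded_closed_compact.
      exists 2; split; first exact: num_real.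
      move=> x x2 v Kv /=; rewrite (le_trans (vg v))// ltW// (le_lt_trans _ x2)//.
      have : g v <= 1 by rewrite Kv.
      by rewrite /g ge_max => /andP[]; lra.
    rewrite (_ : K = g @^-1` [set 1])//.
    by apply: closed_comp; [move=> v _; exact: gc|exact: closed_eq].
  - by apply: continuous_subspaceT; exact: N_continuous.
  move=> c; rewrite inE => Kc cmin; exists c; split=> // v Kv.
  by apply: cmin; rewrite inE.
have Nc0 : 0 < N c.
  rewrite lt_def rho_ge0 andbT; apply/eqP => /(rho_eq0 hrho) e1.
  have c0 : c = 0 by rewrite -[c](lexpK S) -e1 llog1.
  move: Kc; rewrite /K /= c0 /g !linear0 normr0 maxxx => /esym/eqP.
  by rewrite oner_eq0.
(* The absolute value keeps [m] nonnegative for every real [r]. *)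
pose m := `|r| / N c.
have m0 : 0 <= m by rewrite divr_ge0// ltW.
exists (1 + (m + m ^+ 2)); first by rewrite ltr_pwDl// addr_ge0 ?sqr_ge0.
(* [h] is a gauge of degree 1 for the dilations: when [h] is positive, [dilat h^-1 v] lies in
   [K]. *)
move=> v vr; pose h := Num.max `|pi1 v| (Num.sqrt `|pi2 v|).
have hle1 : `|pi1 v| <= h by rewrite /h le_max lexx.
have hle2 : `|pi2 v| <= h ^+ 2.
  rewrite -[leLHS]sqr_sqrtr// lerXn2r ?nnegrE ?sqrtr_ge0 ?le_max ?lexx ?orbT//.
  by rewrite normr_ge0.
suff hm : h <= m.
  have h0 : 0 <= h by rewrite /h le_max normr_ge0.
  have : h ^+ 2 <= m ^+ 2 by rewrite lerXn2r.
  have := vg v; lra.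
have [h0|h0] := lerP h 0; first exact: le_trans m0.
have Kw : K (dilat h^-1 v).
  rewrite /K /= /g (pi1_dil V12 V12f) (pi2_dil V12 V12f).
  rewrite (normrZ h^-1) (normrZ (h^-1 ^+ 2)).
  rewrite (ger0_norm (_ : 0 <= h^-1)) ?invr_ge0 ?ltW//.
  rewrite (ger0_norm (_ : 0 <= h^-1 ^+ 2)) ?sqr_ge0//.
  rewrite exprVn; apply/eqP; rewrite eq_le ge_max !ler_pdivrMl ?exprn_gt0// !mulr1.
  rewrite hle1 hle2 /= le_max !ler_pdivlMl ?exprn_gt0// !mulr1.
  have [hl|hl] := lerP (Num.sqrt `|pi2 v|) `|pi1 v|.
    have hE : h = `|pi1 v| by rewrite /h max_l.
    by apply/orP; left; rewrite hE.
  have hE : h = Num.sqrt `|pi2 v| by rewrite /h max_r// ltW.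
  by apply/orP; right; rewrite hE sqr_sqrtr.
rewrite /m ler_pdivlMr//; apply: (@le_trans _ _ (N v)); last first.
  exact: le_trans vr (ler_norm _).
rewrite -[v in leRHS](dilK V12 V12f v (lt0r_neq0 h0)) N_dil// ler_pM2l//.
exact: cmin.
Qed.

(** A dilation by a factor slightly below 1 moves bounded points little; it serves to bring points
    back into a ball. *)
Lemma rho_shrink M e : 0 < e -> exists2 l, 0 < l < 1 &
  forall v, `|v| <= M -> rho (lexp S v) (lexp S (dilat l v)) <= e.
Proof.
move=> e0; have [d d0 dP] := rho_unif M e0.
have [P P0 [P1 P2]] := pi_bound (V1 S) (V2 S).
have K0 : 0 < 3 * P * (`|M| + 1) by rewrite !mulr_gt0// ltr_wpDl.
pose m := Num.min (1 / 2) (d / (2 * (3 * P * (`|M| + 1)))).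
have m0 : 0 < m by rewrite /m lt_min !divr_gt0// mulr_gt0.
have m2 : m <= 1 / 2 by rewrite /m ge_min lexx.
have md : m <= d / (2 * (3 * P * (`|M| + 1))) by rewrite /m ge_min lexx orbT.
exists (1 - m); first by apply/andP; split; lra.
move=> v vM; apply: dP => //.
have -> : v - dilat (1 - m) v = m *: pi1 v + (m * (2 - m)) *: pi2 v.
  rewrite /dilv -{1}(pi12 V12 V12f v).
  by apply/rowP => i; rewrite !mxE; ring.
rewrite (le_lt_trans (ler_normD _ _))// (normrZ m) (normrZ (m * (2 - m))).
have m' : 0 <= m * (2 - m) by rewrite mulr_ge0 ?ltW//; lra.
rewrite (ger0_norm (ltW m0)) (ger0_norm m').
have vM' : `|v| <= `|M| + 1 by rewrite (le_trans vM)// (le_trans (ler_norm _))// lerDl.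
have q1 : m * `|pi1 v| <= m * (P * (`|M| + 1)).
  by rewrite ler_pM2l// (le_trans (P1 v))// ler_pM2l.
have q2 : m * (2 - m) * `|pi2 v| <= 2 * m * (P * (`|M| + 1)).
  rewrite ler_pM//; first by rewrite mulrC ler_pM2r//; lra.
  by rewrite (le_trans (P2 v))// ler_pM2l.
move: md; rewrite ler_pdivlMr ?mulr_gt0//.
lra.
Qed.

(** * Hausdorff convergence of the rescaled sets inside a ball *)

Lemma hausdorff_ge0 (A B : set G) : (0 <= hausdorff_dist rho A B)%E.
Proof. by apply/ereal_infP => _ [e [e0 _ _] <-]; rewrite lee_fin. Qed.

Lemma hausdorff_cvg (A B : R -> set G) :
  (forall e, 0 < e -> \forall r \near 0^'+,
    (forall a, A r a -> exists2 b, B r b & rho a b <= e) /\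
    (forall b, B r b -> exists2 a, A r a & rho a b <= e)) ->
  (fun r => hausdorff_dist rho (A r) (B r)) @ 0^'+ --> (0 : R)%:E.
Proof.
move=> H; have H' e : 0 < e ->
    \forall r \near 0^'+, (hausdorff_dist rho (A r) (B r) <= e%:E)%E.
  move=> e0; have := H e e0; apply: filterS => r [AB BA].
  by apply: ge_ereal_inf; exists e%:E => //; exists e => //; split=> //; exact: ltW.
have fin r e : (hausdorff_dist rho (A r) (B r) <= e%:E)%E ->
    hausdorff_dist rho (A r) (B r) \is a fin_num.
  move=> He; rewrite ge0_fin_numE ?hausdorff_ge0//.
  by apply: le_lt_trans He _; rewrite ltry.
apply/fine_cvgP; split.
  by have := H' 1 ltr01; apply: filterS => r; exact: fin.
apply/cvgrPdist_le => e e0; have := H' e e0; apply: filterS => r He.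
rewrite /= sub0r normrN ger0_norm ?fine_ge0 ?hausdorff_ge0//.
by rewrite -lee_fin fineK// (fin _ e).
Qed.

Lemma rescaledE (Sigma : set G) x r v : 0 < r ->
  rescaled S Sigma x r (lexp S v) <-> Sigma (x * lexp S (dilat r v))%g.
Proof.
move=> r0; have rn0 : r != 0 by rewrite gt_eqF.
split=> [[_ [y Sy <-]] /(congr1 (llog S))|Sv].
  rewrite /gdil !lexpK => <-.
  by rewrite (dilK V12 V12f) // llogK mulVKg.
exists (lexp S (dilat r v)); first by exists (x * lexp S (dilat r v))%g; rewrite ?mulKg.
by rewrite /gdil lexpK; congr (lexp S _); exact: dilVK.
Qed.

(** The approximations of the blow-up may leave the ball. As the cone is dilation invariant, its
    points can be shrunk by a factor [l] near 1: after approximation in one direction, before it in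
    the other. *)
Lemma rescaled_cvg (Sigma : set G) x T s B e :
  param2 [set v | Sigma (x * lexp S v)%g] T s B -> 0 < e ->
  (fun r => hausdorff_dist rho
     (rescaled S Sigma x r `&` cball1 rho e)
     ([set lexp S v | v in cone (V1 S) (V2 S) T B] `&` cball1 rho e))
    @ 0^'+ --> (0 : R)%:E.
Proof.
move=> sP e0; apply: hausdorff_cvg => eta eta0.
have eta2 : 0 < eta / 2 by rewrite divr_gt0.
have [M M0 NM] := N_bounded e.
have [l /andP[l0 l1] lP] := rho_shrink (M + 1) eta2.
(* The margin [e / l - e] allows a cone point just outside the ball to re-enter it after shrinking
   by [l]; the margin [e - l * e] keeps in the ball a point close to a shrunk cone point. *)
pose eta' := Num.min (eta / 2) (Num.min (e / l - e) (e - l * e)).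
have eta'0 : 0 < eta'.
  rewrite !lt_min eta2 !subr_gt0 ltr_pdivlMr// mulrC !gtr_pMl//.
  by rewrite l1.
have [et1 et2 et3] : [/\ eta' <= eta / 2, eta' <= e / l - e & eta' <= e - l * e].
  by rewrite /eta' !ge_min !lexx !orbT.
have [d d0 dP] := rho_unif M eta'0.
pose d' := Num.min 1 (d / 2).
have d'0 : 0 < d' by rewrite lt_min ltr01 divr_gt0.
have [dd1 dd2] : d' <= 1 /\ d' < d.
  by split; [rewrite ge_min lexx|rewrite gt_min; apply/orP; right; lra].
have [r1 r10 r1P] := rescaled_near_cone V12 V12f sP M0 d'0.
have [r2 r20 r2P] := cone_near_rescaled V12 V12f sP M0 d'0.
near=> r.
have r0 : 0 < r by near: r; exact: nbhs_right_gt.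
have rr1 : 0 < r < r1 by rewrite r0; near: r; exact: nbhs_right_lt.
have rr2 : 0 < r < r2 by rewrite r0; near: r; exact: nbhs_right_lt.
split=> [a|b].
  rewrite -[a](llogK S); set z := llog S a => -[/(rescaledE _ _ _ r0) Sz Nz].
  have zM : `|z| <= M by exact: NM.
  have [c cc zc] := r1P r z rr1 zM Sz.
  have rzc := dP z c zM (le_lt_trans zc dd2).
  have cM : `|c| <= M + 1.
    rewrite -[c](subKr z) (le_trans (ler_normB _ _))// lerD// (le_trans zc)//.
  have Nc : N c <= e / l.
    have := rho_triangle hrho 1%g (lexp S z) (lexp S c).
    by move: Nz rzc et2; rewrite /cball1 /=; lra.
  exists (lexp S (dilat l c)); first split.
  - by exists (dilat l c) => //; exact: (cone_dil V12 V12f sP).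
  - by rewrite /cball1 /= N_dil// mulrC -ler_pdivlMr.
  have := rho_triangle hrho (lexp S z) (lexp S c) (lexp S (dilat l c)).
  have := lP c cM; lra.
move=> [[c cc <-] Nc]; have cM : `|c| <= M by exact: NM.
have cM1 : `|c| <= M + 1 by rewrite (le_trans cM)// lerDl.
have Nlc : N (dilat l c) <= l * e by rewrite N_dil// ler_pM2l.
have lcM : `|dilat l c| <= M.
  by apply: NM; rewrite (le_trans Nlc)//; apply: ler_piMl; exact: ltW.
have [z Sz zc] := r2P r _ rr2 (cone_dil V12 V12f sP l cc) lcM.
have rzc : rho (lexp S (dilat l c)) (lexp S z) <= eta'.
  by apply: dP => //; rewrite distrC (le_lt_trans zc).
exists (lexp S z); first split.
- exact/rescaledE.
- have := rho_triangle hrho 1%g (lexp S (dilat l c)) (lexp S z).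
  by rewrite /cball1 /=; lra.
have := rho_triangle hrho (lexp S c) (lexp S (dilat l c)) (lexp S z).
rewrite (rho_sym hrho (lexp S z)).
have := lP c cM1; lra.
Unshelve. all: by end_near. Qed.

End Distance.

(** * Orthonormal bases adapted to the cone *)

Lemma linear_sum_scale (R : realType) (U W : lmodType R) (f : U -> W) I (r : seq I)
    (P : pred I) (c : I -> R) (w : I -> U) : linear f ->
  f (\sum_(i <- r | P i) c i *: w i) = \sum_(i <- r | P i) c i *: f (w i).
Proof.
move=> /linearDZ[f0 fD _ _ fZ]; rewrite (big_morph f fD f0).
by apply: eq_bigr => i _.
Qed.

Section Orthonormal.
Context (R : realType) (q : nat) (g : 'rV[R]_q -> 'rV[R]_q -> R).
Hypotheses (g_lin : forall a (u v w : 'rV[R]_q), g (a *: u + v) w = a * g u w + g v w)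
  (g_sym : forall u v, g u v = g v u)
  (g_gt0 : forall v : 'rV[R]_q, v != 0 -> 0 < g v v).
Implicit Types (X Y : seq 'rV[R]_q) (U : {vspace 'rV[R]_q}).

Let gl w : linear (fun u => g u w : R^o).
Proof. by move=> a u v; exact: g_lin. Qed.

Lemma g_sum I (r : seq I) (P : pred I) (c : I -> R) (w : I -> 'rV[R]_q) u :
  g (\sum_(i <- r | P i) c i *: w i) u = \sum_(i <- r | P i) c i * g (w i) u.
Proof. exact: (linear_sum_scale _ _ _ _ (gl u)). Qed.

Lemma g0 u : g 0 u = 0. Proof. by have [] := linearDZ (gl u). Qed.
Lemma gD u v w : g (u + v) w = g u w + g v w.
Proof. by have [_ D _ _ _] := linearDZ (gl w). Qed.
Lemma gB u v w : g (u - v) w = g u w - g v w.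
Proof. by have [_ _ _ D _] := linearDZ (gl w). Qed.
Lemma gZ a u w : g (a *: u) w = a * g u w.
Proof. by have [_ _ _ _ D] := linearDZ (gl w). Qed.

Definition orthon X := forall i j, (i < size X)%N -> (j < size X)%N ->
  g X`_i X`_j = (i == j)%:R.

Lemma orthon_coord X (c : 'I_(size X) -> R) (j : 'I_(size X)) : orthon X ->
  g (\sum_(i < size X) c i *: X`_i) X`_j = c j.
Proof.
move=> oX; rewrite g_sum (bigD1 j)//= oX// eqxx mulr1 big1 ?addr0// => i ij.
by rewrite oX// (negbTE (ij : nat_of_ord i != j)) mulr0.
Qed.

Lemma orthon_free X : orthon X -> free X.
Proof.
move=> oX; apply/(freeP (X := in_tuple X)) => c c0 i.
by rewrite -(orthon_coord c i oX) /= c0 g0.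
Qed.

Lemma orthon_expand X u : orthon X -> u \in <<X>>%VS ->
  u = \sum_(i < size X) g u X`_i *: X`_i.
Proof.
move=> oX uX; have := coord_span (X := in_tuple X) uX => /= uE.
rewrite {1}uE; apply: eq_bigr => i _; congr (_ *: _).
by rewrite {2}uE orthon_coord.
Qed.

(** One Gram-Schmidt step: [u] minus its orthogonal projection onto the span, normalized. *)
Lemma orthon_rcons X u : orthon X -> u \notin <<X>>%VS ->
  exists2 w, w \in (<<X>> + <[u]>)%VS & orthon (rcons X w).
Proof.
move=> oX uX; pose v := u - \sum_(i < size X) g u X`_i *: X`_i.
have pX : \sum_(i < size X) g u X`_i *: X`_i \in <<X>>%VS.
  by apply: memv_suml => i _; apply/memvZ/memv_span/mem_nth.
have v0 : v != 0 by apply: contra uX; rewrite subr_eq0 => /eqP ->.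
have vX j : (j < size X)%N -> g v X`_j = 0.
  by move=> jX; rewrite gB (orthon_coord (fun i => g u X`_i) (Ordinal jX) oX) subrr.
have gv := g_gt0 v0.
have sq : Num.sqrt (g v v) != 0 by rewrite gt_eqF// sqrtr_gt0.
exists ((Num.sqrt (g v v))^-1 *: v).
  apply: memvZ; rewrite addvC; apply: memv_add; first exact: memv_line.
  by rewrite memvN.
set w := _ *: v.
have wX j : (j < size X)%N -> g w X`_j = 0 by move=> jX; rewrite gZ vX// mulr0.
have ww : g w w = 1.
  rewrite gZ g_sym gZ mulrA -invfM -expr2 sqr_sqrtr ?ltW// mulVf//.
  by rewrite gt_eqF.
move=> i j; rewrite size_rcons !ltnS !nth_rcons.
case: (ltngtP i (size X)) => iX; case: (ltngtP j (size X)) => jX //= _ _.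
- exact: oX.
- by rewrite jX g_sym wX// ltn_eqF.
- by rewrite iX wX// gtn_eqF.
- by rewrite iX jX eqxx.
Qed.

(** Gram-Schmidt steps are repeated, by induction on the number of missing vectors
    [\dim U - size X]. *)
Lemma orthon_extend U X : orthon X -> (<<X>> <= U)%VS ->
  exists Y, orthon (X ++ Y) /\ basis_of U (X ++ Y).
Proof.
have [k] := ubnP (\dim U - size X); elim: k X => // k IH X kX oX XU.
have sX : size X = \dim <<X>> by rewrite (eqP (orthon_free oX)).
have [UX|/subvPn[u uU uX]] := boolP (U <= <<X>>)%VS.
  exists [::]; rewrite cats0; split=> //.
  by rewrite /basis_of orthon_free// andbT eqEsubv XU.
have [w wXu ow] := orthon_rcons oX uX.
have XwU : (<<rcons X w>> <= U)%VS.
  apply/span_subvP => z; rewrite mem_rcons inE => /orP[/eqP ->|zX]; last first.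
    exact: (subvP XU) _ (memv_span zX).
  by apply: subvP wXu; rewrite subv_add XU -memvE.
have [|Y [oY bY]] := IH (rcons X w) _ ow XwU; last first.
  by exists (w :: Y); rewrite -cat_rcons.
have : (size (rcons X w) <= \dim U)%N.
  by rewrite -(eqP (orthon_free ow)) dimvS.
rewrite size_rcons => XU'; rewrite -ltnS; apply: leq_trans kX.
by rewrite ltnS subnS prednK// subn_gt0.
Qed.

Lemma orthon_cat X Y : orthon X -> orthon Y ->
  (forall x y, x \in X -> y \in Y -> g x y = 0) -> orthon (X ++ Y).
Proof.
move=> oX oY XY i j; rewrite size_cat !nth_cat => iXY jXY.
have [iX|iX] := ltnP i (size X); have [jX|jX] := ltnP j (size X).
- exact: oX.
- by rewrite XY ?mem_nth ?ltn_subLR// ltn_eqF// (leq_trans iX).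
- by rewrite g_sym XY ?mem_nth ?ltn_subLR// gtn_eqF// (leq_trans jX).
rewrite oY ?ltn_subLR//; congr (_%:R); congr nat_of_bool.
by rewrite -(eqn_add2l (size X)) !subnKC.
Qed.

End Orthonormal.

(** * Index sets of the adapted basis *)

(** Adding the indices below [d] to the two blocks gives, with multiplicity, the indices below [k1]
    and those below [d + k2]; only initial segments remain to be counted. *)
Lemma card_blocks (q k1 d k2 : nat) : (k1 <= d)%N -> (d + k2 <= q)%N ->
  #|[set i : 'I_q | (i < k1)%N || (d <= i < d + k2)%N]%SET| = (k1 + k2)%N.
Proof.
move=> k1d dk2.
have cnt (s : seq 'I_q) :
    (count (fun i : 'I_q => (i < k1) || (d <= i < d + k2)) s +
       count (fun i : 'I_q => i < d) s =
     count (fun i : 'I_q => i < k1) s + count (fun i : 'I_q => i < d + k2) s)%N.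
  elim: s => //= x s IH.
  have : (((x < k1) || (d <= x < d + k2)) + (x < d) = (x < k1) + (x < d + k2))%N.
    have xd_lt : (x < d)%N -> (x < d + k2)%N.
      by move=> xd; rewrite (leq_trans xd)// leq_addr.
    have xk_lt : (x < k1)%N -> (x < d)%N by move=> xk; rewrite (leq_trans xk).
    move: xd_lt xk_lt; rewrite (leqNgt d x).
    by case: (x < k1)%N; case: (x < d)%N; case: (x < d + k2)%N => //= a b;
      first [by have := a isT | by have := b isT].
  by move=> e; rewrite addnACA e IH addnACA.
have d_q : (d <= q)%N := leq_trans (leq_addr _ _) dk2.
have := cnt (enum 'I_q).
rewrite !count_ord_lt// ?(leq_trans k1d)// (addnCA k1 d) addnC => /addnI <-.
rewrite cardE {1}/enum_mem size_filter -enumT; apply: eq_count => i.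
by rewrite !inE.
Qed.

Lemma map_nth_ord_lt (R : realType) q (s : seq 'rV[R]_q) d : size s = q -> (d <= q)%N ->
  [seq s`_(val i) | i : 'I_q <- enum 'I_q & (i < d)%N] = take d s.
Proof.
move=> sq dq; rewrite (map_comp (nth 0 s) val).
rewrite -(filter_map _ (fun k => k < d)%N) val_enum_ord.
by have := filter_iota_ltn 0 dq; rewrite add0n => ->; rewrite map_nth_iota0 ?sq.
Qed.

Lemma map_nth_ord_ge (R : realType) q (s : seq 'rV[R]_q) d : size s = q -> (d <= q)%N ->
  [seq s`_(val i) | i : 'I_q <- enum 'I_q & (d <= i)%N] = drop d s.
Proof.
move=> sq dq; rewrite (map_comp (nth 0 s) val).
rewrite -(filter_map _ (fun k => d <= k)%N) val_enum_ord.
have -> : [seq i <- iota 0 q | (d <= i)%N] = iota d (q - d).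
  rewrite -{1}(subnKC dq) iotaD add0n filter_cat.
  rewrite (_ : seq.filter _ (iota 0 d) = [::]); last first.
    apply/eqP; rewrite -(negbK (_ == _)) -has_filter; apply/hasPn => i.
    by rewrite mem_iota add0n -ltnNge => /andP[].
  by apply/all_filterP/allP => i; rewrite mem_iota => /andP[].
by rewrite map_nth_iota ?sq// take_oversize// size_drop sq.
Qed.

Section AdaptedBasis.
Context (R : realType) (q : nat) (G : groupType) (S : two_step_group R q G).
Context (g : 'rV[R]_q -> 'rV[R]_q -> R) (hg : graded_metric S g).
Context (A1 A2 : {vspace 'rV[R]_q}).
Hypotheses (A1V : (A1 <= V1 S)%VS) (A2V : (A2 <= V2 S)%VS).

(** Orthonormal bases of [A1] and [A2] are extended to [V1] and [V2] and concatenated; [K] records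
    the positions of the vectors from [A1] and [A2]. The last clause makes the coordinates outside
    [K] vanish on [A1] and [A2]. *)
Lemma adapted_basis : exists (W : 'I_q -> 'rV[R]_q) (K : {set 'I_q}),
  [/\ graded_basis S g W, #|K| = (\dim A1 + \dim A2)%N,
    (forall i : 'I_q, if (i < \dim (V1 S))%N then W i \in V1 S else W i \in V2 S) &
    [/\ (forall i : 'I_q, i \in K ->
        if (i < \dim (V1 S))%N then W i \in A1 else W i \in A2) &
      (forall u j, u \in A1 \/ u \in A2 -> j \notin K -> g u (W j) = 0)]].
Proof.
have gl := metric_linear hg; have gs := Defs.metric_sym hg; have gp := metric_gt0 hg.
have go := metric_orth hg.
have nilo : orthon g [::] by [].
have nilU U : (<<[::] : seq 'rV[R]_q>> <= U)%VS by rewrite span_nil sub0v.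
have [X1 [/= oX1 bX1]] := orthon_extend gl gs gp nilo (nilU A1).
have [X2 [/= oX2 bX2]] := orthon_extend gl gs gp nilo (nilU A2).
have X1V : (<<X1>> <= V1 S)%VS by rewrite (span_basis bX1).
have X2V : (<<X2>> <= V2 S)%VS by rewrite (span_basis bX2).
have [Y1 [oY1 bY1]] := orthon_extend gl gs gp oX1 X1V.
have [Y2 [oY2 bY2]] := orthon_extend gl gs gp oX2 X2V.
set Z1 := X1 ++ Y1 in oY1 bY1; set Z2 := X2 ++ Y2 in oY2 bY2.
pose s := Z1 ++ Z2.
have os : orthon g s.
  apply: (orthon_cat gs oY1 oY2) => x y xZ yZ; apply: go.
    exact: (basis_mem bY1).
  exact: (basis_mem bY2).
have szb (U : {vspace 'rV[R]_q}) X : basis_of U X -> size X = \dim U.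
  by move=> /andP[/eqP <- /eqP <-].
have sZ1 : size Z1 = \dim (V1 S) := szb _ _ bY1.
have sZ2 : size Z2 = \dim (V2 S) := szb _ _ bY2.
have dq : (\dim (V1 S) + \dim (V2 S))%N = q.
  by rewrite -(dimv_disjoint_sum (V1V2_direct S)) V1V2_full dimvf /dim /= mul1n.
have sq : size s = q by rewrite size_cat sZ1 sZ2.
have d1q : (\dim (V1 S) <= q)%N by apply: leq_trans (leq_addr _ _) (eq_leq dq).
have sX1 : size X1 = \dim A1 := szb _ _ bX1.
have sX2 : size X2 = \dim A2 := szb _ _ bX2.
have le1 : (\dim A1 <= \dim (V1 S))%N := dimvS A1V.
have le2 : (\dim A2 <= \dim (V2 S))%N := dimvS A2V.
pose W (i : 'I_q) := s`_(val i).
pose K : {set 'I_q} := [set i : 'I_q | (i < \dim A1)%N ||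
  (\dim (V1 S) <= i < \dim (V1 S) + \dim A2)%N]%SET.
have gW (i j : 'I_q) : g (W i) (W j) = (i == j)%:R by rewrite /W os ?sq ?ltn_ord.
have bV1 : basis_of (V1 S) [seq W i | i : 'I_q <- enum 'I_q & (i < \dim (V1 S))%N].
  by rewrite map_nth_ord_lt// -sZ1 take_size_cat.
have bV2 : basis_of (V2 S) [seq W i | i : 'I_q <- enum 'I_q & (\dim (V1 S) <= i)%N].
  by rewrite map_nth_ord_ge// -sZ1 drop_size_cat.
have WV (i : 'I_q) : if (i < \dim (V1 S))%N then W i \in V1 S else W i \in V2 S.
  case: ltnP => id.
    by apply: (basis_mem bV1); apply: map_f; rewrite mem_filter id mem_enum.
  by apply: (basis_mem bV2); apply: map_f; rewrite mem_filter id mem_enum.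
have Xs (i : 'I_q) : (i < \dim A1)%N -> W i \in X1.
  move=> i1; rewrite /W /s nth_cat sZ1 (leq_trans i1)// nth_cat sX1 i1.
  by rewrite mem_nth// sX1.
have Xs2 (i : 'I_q) : (\dim (V1 S) <= i < \dim (V1 S) + \dim A2)%N -> W i \in X2.
  move=> /andP[i1 i2]; rewrite /W /s nth_cat sZ1 ltnNge i1 /= nth_cat sX2.
  by rewrite ltn_subLR// i2 mem_nth// sX2 ltn_subLR.
exists W, K; split=> //.
  by apply: card_blocks => //; rewrite -[leqRHS]dq leq_add2l.
split=> [i|u j uA].
  rewrite inE => /orP[i1|i2].
    by rewrite (leq_trans i1)//; apply: (basis_mem bX1); exact: Xs.
  have /andP[i21 _] := i2; rewrite ltnNge i21 /=.
  by apply: (basis_mem bX2); exact: Xs2.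
rewrite inE negb_or => /andP[j1 j2].
have main (X : seq 'rV[R]_q) : orthon g X -> u \in <<X>>%VS ->
    (forall i, (i < size X)%N -> exists2 k : 'I_q, X`_i = W k & k != j) ->
    g u (W j) = 0.
  move=> oX uX XW; rewrite (orthon_expand gl oX uX) (g_sum gl) big1// => i _.
  by have [k -> /negbTE kj] := XW i (ltn_ord i); rewrite gW kj mulr0.
case: uA => [uA1|uA2].
  apply: (main X1) => [//||i]; first by rewrite (span_basis bX1).
  rewrite sX1 => i1.
  have iq : (i < q)%N by rewrite (leq_trans i1)// (leq_trans le1).
  exists (Ordinal iq).
    by rewrite /W /s /= nth_cat sZ1 (leq_trans i1)// nth_cat sX1 i1.
  by apply: contraNneq j1 => <-.
apply: (main X2) => [//||i]; first by rewrite (span_basis bX2).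
rewrite sX2 => i2.
have iq : (\dim (V1 S) + i < q)%N.
  by rewrite -[ltnRHS]dq ltn_add2l (leq_trans i2).
exists (Ordinal iq).
  by rewrite /W /s /= nth_cat sZ1 ltnNge leq_addr /= addKn nth_cat sX2 i2.
by apply: contraNneq j2 => <-; rewrite /= leq_addr ltn_add2l.
Qed.

End AdaptedBasis.

(** * The cone as a polynomial graph *)

Definition qpoly (R : realType) n (c : 'I_n -> 'I_n -> R) : mpoly.mpoly n R :=
  \sum_k \sum_l c k l *: (mpolyX R (mnm1 k) * mpolyX R (mnm1 l)).

Lemma qpolyE (R : realType) n (c : 'I_n -> 'I_n -> R) (xi : 'I_n -> R) :
  mpoly.meval xi (qpoly c) = \sum_k \sum_l c k l * (xi k * xi l).
Proof.
rewrite /qpoly raddf_sum /=; apply: eq_bigr => k _.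
rewrite raddf_sum /=; apply: eq_bigr => l _.
by rewrite mevalZ mevalM !mevalXU.
Qed.

Lemma bilin_sum (R : realType) (U W : lmodType R) (B : U -> U -> W)
    n (c : 'I_n -> R) (w : 'I_n -> U) : bilin B ->
  B (\sum_i c i *: w i) (\sum_i c i *: w i) =
  \sum_i \sum_j (c i * c j) *: B (w i) (w j).
Proof.
move=> [lr ll]; rewrite (linear_sum_scale _ _ _ _ (ll _)); apply: eq_bigr => i _.
rewrite (linear_sum_scale _ _ _ _ (lr _)) scaler_sumr; apply: eq_bigr => j _.
by rewrite scalerA.
Qed.

Section Graph.
Context (R : realType) (q : nat) (G : groupType) (S : two_step_group R q G).
Context (g : 'rV[R]_q -> 'rV[R]_q -> R) (hg : graded_metric S g).

Local Notation pi1 := (daddv_pi (V1 S) (V2 S)).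
Local Notation pi2 := (daddv_pi (V2 S) (V1 S)).

Let V12 : (V1 S :&: V2 S = 0)%VS := V1V2_direct S.
Let V12f : (V1 S + V2 S = fullv)%VS := V1V2_full S.
Let gl := metric_linear hg.
Let gs := Defs.metric_sym hg.

Lemma coords_sum (W : 'I_q -> 'rV[R]_q) (y : 'rV[R]_q) j :
  (forall i j, g (W i) (W j) = (i == j)%:R) ->
  g (\sum_i y 0 i *: W i) (W j) = y 0 j.
Proof.
move=> gW; rewrite (g_sum gl) (bigD1 j)//= gW eqxx mulr1 big1 ?addr0// => i ij.
by rewrite gW (negbTE ij) mulr0.
Qed.

Lemma basis_expand (W : 'I_q -> 'rV[R]_q) v : graded_basis S g W ->
  v = \sum_i g v (W i) *: W i.
Proof.
move=> [gW b1 b2].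
have vW : exists y : 'I_q -> R, v = \sum_i y i *: W i.
  have : v \in (V1 S + V2 S)%VS by rewrite V12f memvf.
  move=> /memv_addP[v1 + [v2 + ->]].
  have spanW (P : pred 'I_q) u : u \in span [seq W i | i : 'I_q <- enum 'I_q & P i] ->
      exists y : 'I_q -> R, u = \sum_i y i *: W i.
    (* The defect of the orthonormal expansion is linear and kills each [W k], hence their span. *)
    pose F : 'rV[R]_q -> 'rV[R]_q := fun u => u - \sum_i g u (W i) *: W i.
    have lF : linear F.
      move=> a x z; rewrite /F scalerBr addrACA -opprD; congr (_ - _).
      rewrite scaler_sumr -big_split /=; apply: eq_bigr => i _.
      by rewrite gl scalerDl scalerA.
    pose f : 'End('rV[R]_q) := linfun (HB.pack F (GRing.isLinear.Build _ _ _ _ F lF)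
      : {linear 'rV[R]_q -> 'rV[R]_q}).
    have /subvP fU : (span [seq W i | i : 'I_q <- enum 'I_q & P i] <= lker f)%VS.
      apply/span_subvP => _ /mapP[k _ ->]; rewrite memv_ker lfunE /= /F.
      rewrite (bigD1 k)//= gW eqxx scale1r big1 ?addr0 ?subrr// => i ik.
      by rewrite gW eq_sym (negbTE ik) scale0r.
    move=> /fU; rewrite memv_ker lfunE /= /F subr_eq0 => /eqP uE.
    by exists (fun i => g u (W i)).
  rewrite -(span_basis b1) -(span_basis b2) => /spanW[y1 ->] /spanW[y2 ->].
  exists (fun i => y1 i + y2 i); rewrite -big_split /=; apply: eq_bigr => i _.
  by rewrite scalerDl.
have [y yE] := vW.
have yi i : g v (W i) = y i.
  have := coords_sum (\row_i y i) i gW; rewrite mxE => <-; congr g.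
  by rewrite yE; apply: eq_bigr => k _; rewrite mxE.
by rewrite {1}yE; apply: eq_bigr => i _; rewrite yi.
Qed.

(** The graded coordinates of a point are the linear forms [g v (W i)] of its logarithm [v];
    substituted into the graph equations, they give polynomials in the coordinates of [v]. *)
Lemma homogeneous_graph_variety p (A : set G) :
  homogeneous_polynomial_graph S g p A -> algebraic_variety S A.
Proof.
move=> [W [K [T [gb _ AE _]]]]; have [gW _ _] := gb.
(* There will be [q] equations, and a variety requires at least one. *)
have q0 : (0 < q)%N.
  rewrite lt0n; apply/negP => /eqP q0.
  have := dimvS (subvf (V1 S)); rewrite dimvf /dim /= mul1n.
  by rewrite [X in (_ <= X)%N]q0 leqn0 dimv_eq0 (negbTE (V1_neq0 S)).
pose X (i : 'I_q) : mpoly.mpoly q R :=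
  \sum_k g (delta_mx 0 k) (W i) *: mpolyX R (mnm1 k).
have XE (v : 'rV[R]_q) i : mpoly.meval (fun j => v 0 j) (X i) = g v (W i).
  rewrite /X raddf_sum /= {2}(row_sum_delta v) (g_sum gl).
  by apply: eq_bigr => k _; rewrite mevalZ mevalXU mulrC.
(* The zero polynomial at the indices of [K] imposes no condition there. *)
pose Q (i : 'I_q) : mpoly.mpoly q R := if i \in K then 0 else
  X i - comp_mpoly [tuple X (enum_val k) | k < #|K|] (T i).
have QE (v : 'rV[R]_q) i : mpoly.meval (fun j => v 0 j) (Q i) = if i \in K then 0 else
    g v (W i) - mpoly.meval (fun k => g v (W (enum_val k))) (T i).
  rewrite /Q; case: ifP => _; first exact: meval0.
  rewrite mevalB XE comp_mpoly_meval; congr (_ - _).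
  by apply: meval_eq => k; rewrite tnth_mktuple XE.
exists q, (fun x => \row_i mpoly.meval (fun j => llog S x 0 j) (Q i)).
split=> //; first by exists Q => v i; rewrite mxE lexpK.
rewrite AE; apply/seteqP; split=> x /=.
  move=> [y yT <-]; apply/rowP => i; rewrite !mxE QE /graded_coord lexpK.
  case: ifPn => // iK; rewrite coords_sum// yT//; apply/eqP; rewrite subr_eq0.
  by apply/eqP; apply: meval_eq => k; rewrite coords_sum.
move=> xP; exists (\row_i g (llog S x) (W i)).
  move=> j jK; move: xP => /rowP/(_ j); rewrite !mxE QE (negbTE jK) => /eqP.
  by rewrite subr_eq0 => /eqP ->; apply: meval_eq => k; rewrite mxE.
rewrite /graded_coord -[RHS](llogK S); congr (lexp S _).
rewrite [RHS](basis_expand _ gb); apply: eq_bigr => i _.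
by rewrite mxE.
Qed.

(** In a basis adapted to [horT] and [pi2 (verT)], the coordinates of [conept a b] outside [K]
    vanish in [V1] and, in [V2], see only [pi2 (B a a)]. Since [a] is read off the horizontal
    coordinates in [K], these are quadratic forms in variables of degree 1, thus of degree 2. *)
Lemma cone_graph (T : {vspace 'rV[R]_q}) (B : 'rV[R]_q -> 'rV[R]_q -> 'rV[R]_q) :
  bilin B ->
  homogeneous_polynomial_graph S g (\dim T)
    [set lexp S v | v in cone (V1 S) (V2 S) T B].
Proof.
move=> bB; set A1 := horT (V1 S) T; set T2 := (pi2 @: verT (V1 S) T)%VS.
have A1V : (A1 <= V1 S)%VS by exact: capvSr.
have T2V : (T2 <= V2 S)%VS.
  by apply/subvP => _ /memv_imgP[b _ ->]; exact: pi2_in.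
have [W [K [gb cK WV [KA Kc]]]] := adapted_basis hg A1V T2V.
have WE v := basis_expand v gb.
have [gW _ _] := gb.
have go := metric_orth hg.
have go' u v : u \in V2 S -> v \in V1 S -> g u v = 0 by move=> u2 v1; rewrite gs go.
set d := \dim (V1 S) in WV KA.
have W1 (i : 'I_q) : (i < d)%N -> W i \in V1 S by move=> id; have := WV i; rewrite id.
have W2 (i : 'I_q) : (d <= i)%N -> W i \in V2 S.
  by move=> id; have := WV i; rewrite ltnNge id.
have deg1 (i : 'I_q) : (i < d)%N -> coord_degree S W i = 1%N.
  by move=> id; rewrite /coord_degree W1.
have deg2 (i : 'I_q) : (d <= i)%N -> coord_degree S W i = 2%N.
  move=> id; rewrite /coord_degree; case: ifPn => // W1i.
  by have := gW i i; rewrite (go _ _ W1i (W2 i id)) eqxx => /esym/eqP; rewrite oner_eq0.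
(* Only horizontal variables enter, and only for a vertical coordinate [j]; otherwise the polynomial
   is zero. *)
pose c (j : 'I_q) (k l : 'I_#|K|) : R :=
  if [&& enum_val k < d, enum_val l < d & d <= j]%N
  then g (pi2 (B (W (enum_val k)) (W (enum_val l)))) (W j) else 0.
(* [hor] rebuilds the parameter [a] from the horizontal coordinates indexed by [K]. *)
pose hor (y : 'I_q -> R) : 'rV[R]_q :=
  \sum_(k < #|K|) (if (enum_val k < d)%N then y (enum_val k) else 0) *: W (enum_val k).
have horE (y : 'I_q -> R) (j : 'I_q) :
    mpoly.meval (fun k => y (enum_val k)) (qpoly (c j)) =
    if (d <= j)%N then g (pi2 (B (hor y) (hor y))) (W j) else 0.
  rewrite qpolyE; case: ifPn => dj; last first.
    rewrite big1// => k _; rewrite big1// => l _.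
    by rewrite /c (negbTE dj) !andbF mul0r.
  have gsum (u : 'I_#|K| -> 'rV[R]_q) :
      g (\sum_k u k) (W j) = \sum_k g (u k) (W j).
    rewrite (big_morph (fun u => g u (W j)) (id1 := 0) (op1 := +%R))//.
      by move=> v w; exact: (gD gl).
    exact: (g0 gl).
  rewrite /hor bilin_sum// linear_sum /= gsum; apply: eq_bigr => k _.
  rewrite linear_sum /= gsum; apply: eq_bigr => l _.
  rewrite linearZ /= (gZ gl) /c dj andbT mulrC.
  by case: (ltnP (enum_val k) d) => _; case: (ltnP (enum_val l) d) => _;
    rewrite /= ?mul0r ?mulr0 ?mul0r.
have horA y : hor y \in A1.
  apply: memv_suml => k _; case: ifP => kd; last by rewrite scale0r mem0v.
  by apply: memvZ; have := KA _ (enum_valP k); rewrite kd.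
have horK y : hor y = \sum_(i in K) (if (i < d)%N then y i else 0) *: W i.
  rewrite /hor.
  by rewrite (big_enum_val (fun i : 'I_q => (if (i < d)%N then y i else 0) *: W i)).
have hor_all y : (forall j : 'I_q, j \notin K -> (j < d)%N -> y j = 0) ->
    hor y = \sum_(i < q) (if (i < d)%N then y i else 0) *: W i.
  move=> y0; rewrite horK big_mkcond /=; apply: eq_bigr => i _.
  case: ifPn => // iK; case: ifP => id; last by rewrite scale0r.
  by rewrite y0// scale0r.
exists W, K, (fun j => qpoly (c j)); split=> //.
(* [verT] has the dimension of its image since [pi2] is injective on it. *)
- rewrite cK -(dimv_cap_compl T (V1 S)); congr addn.
  by rewrite limg_dim_eq//; exact: verT_inj.
- apply/seteqP; split=> x /=.
    move=> [v [a [b [aA bT vE]]] <-]; exists (\row_i g v (W i)); last first.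
      rewrite /graded_coord; congr (lexp S _); rewrite [RHS]WE.
      by apply: eq_bigr => i _; rewrite mxE.
    have gb1 (j : 'I_q) : (j < d)%N -> g v (W j) = g a (W j).
      move=> jd; rewrite vE /conept !(gD gl) (go' _ _ (pi2_in _ _ _) (W1 _ jd)).
      by rewrite (go' _ _ (pi2_in _ _ _) (W1 _ jd)) !addr0.
    have aK (j : 'I_q) : j \notin K -> g a (W j) = 0 by move=> jK; apply: Kc jK; left.
    have aE : hor (fun i => g v (W i)) = a.
      rewrite hor_all => [|j jK jd]; last by rewrite gb1// aK.
      rewrite [RHS]WE; apply: eq_bigr => i _; case: ltnP => id; first by rewrite gb1.
      by rewrite (go _ _ _ (W2 _ id)) ?(subvP A1V).
    move=> j jK; rewrite mxE.
    rewrite (meval_eq (v2 := fun k => g v (W (enum_val k)))); last first.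
      by move=> k; rewrite mxE.
    rewrite (horE (fun i => g v (W i))) aE; case: leqP => jd; last by rewrite gb1// aK.
    rewrite vE /conept !(gD gl) aK// add0r Kc ?add0r//.
    by right; apply: memv_img.
  move=> [y yT <-]; set v := \sum_i y 0 i *: W i.
  have vW j : g v (W j) = y 0 j by exact: coords_sum.
  set a := hor (fun i => y 0 i).
  have yT' (j : 'I_q) : j \notin K ->
      y 0 j = if (d <= j)%N then g (pi2 (B a a)) (W j) else 0.
    by move=> jK; rewrite yT// (horE (fun i => y 0 i)).
  have pv : pi1 v = a.
    rewrite /a hor_all => [|j jK jd]; last by rewrite yT'// leqNgt jd.
    rewrite /v linear_sum /=; apply: eq_bigr => i _; rewrite linearZ /=.
    case: ltnP => id; first by rewrite pi1_id// W1.
    by rewrite (pi1_0 V12 V12f (W2 _ id)) scaler0 scale0r.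
  (* Its coordinates along [V1] vanish by orthogonality, and its vertical coordinates outside [K]
     vanish by the graph equations; what remains lies in [pi2 (verT)] and provides [b]. *)
  have /memv_imgP[b bT bE] : pi2 v - pi2 (B a a) \in T2.
    rewrite [X in X \in _]WE; apply: memv_suml => i _.
    have [iK|iK] := boolP (i \in K); last first.
      suff -> : g (pi2 v - pi2 (B a a)) (W i) = 0 by rewrite scale0r mem0v.
      have [id|id] := ltnP i d.
        by rewrite go' ?W1// memvB// pi2_in.
      have vi : g v (W i) = g (pi2 v) (W i).
        rewrite -{1}(pi12 V12 V12f v) (gD gl) (go _ _ (pi1_in _ _ _) (W2 _ id)).
        by rewrite add0r.
      by rewrite (gB gl) -vi vW yT'// id subrr.
    have := KA i iK; case: ltnP => id Wi; last exact: memvZ.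
    suff -> : g (pi2 v - pi2 (B a a)) (W i) = 0 by rewrite scale0r mem0v.
    by rewrite go' ?W1// memvB// pi2_in.
  exists v => //; exists a, b; split=> //; first exact: horA.
  by rewrite /conept -bE -addrA subrK -{1}(pi12 V12 V12f v) pv.
- move=> j jK r xi r0; rewrite !qpolyE.
  rewrite mulr_sumr; apply: eq_bigr => k _; rewrite mulr_sumr; apply: eq_bigr => l _.
  rewrite /c; case: ifPn => [/and3P[kd ld jd]|_]; last by rewrite !mul0r mulr0.
  by rewrite (deg1 _ kd) (deg1 _ ld) (deg2 _ jd); ring.
Qed.

End Graph.

Theorem theorem1p4 (R : realType) (q : nat) (G : groupType)
    (S : two_step_group R q G)
    (rho : G -> G -> R) (hrho : homogeneous_distance S rho)
    (g : 'rV[R]_q -> 'rV[R]_q -> R) (hg : graded_metric S g)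
    (p : nat) (Sigma : set G) (hSigma : C2_submanifold S p Sigma)
    (x : G) (hx : Sigma x) :
  exists A : set G,
    [/\ algebraic_variety S A,
        homogeneous_polynomial_graph S g p A &
        forall e : R, 0 < e ->
          (fun r : R => hausdorff_dist rho
             (rescaled S Sigma x r `&` cball1 rho e) (A `&` cball1 rho e))
            @ 0^'+ --> (0 : R)%:E].
Proof.
have [T [s [B [<- sP]]]] := submanifold_param2 hSigma hx.
have [bB _ _ _] := sP.
have graph := cone_graph hg T bB.
exists [set lexp S v | v in cone (V1 S) (V2 S) T B]; split=> //.
  exact: (homogeneous_graph_variety hg graph).
by move=> e e0; exact: (rescaled_cvg hrho sP e0).
Qed.
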